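(* Let $\hat{\mathcal T}$ be a regular refinement of $\mathcal T$ (both in $\mathbb T$), let $u_{CR}\in CR^1_0(\mathcal T)$ and $\hat u_{CR}\in CR^1_0(\hat{\mathcal T})$ be the Crouzeix–Raviart FEM solutions with right-hand side $f\in L^2(\Omega)$, and let $\Lambda_1^2:=48\cot(\omega_0)(2\sin(\omega_0))^{-1/2}$. Then $$|\eta_{CR}(\mathcal T,\mathcal T\cap\hat{\mathcal T})-\eta_{CR}(\hat{\mathcal T},\mathcal T\cap\hat{\mathcal T})|\le\Lambda_1\|\nabla_{NC}(u_{CR}-\hat u_{CR})\|_{L^2(\Omega)}.$$
   Context: $\Omega\subset\mathbb R^2$ is a bounded polygonal Lipschitz domain, $\mathbb T$ is the set of regular triangulations obtained from an initial triangulation by successive newest-vertex bisections, and $\omega_0>0$ is a lower bound for all interior angles of all triangles involved. $CR^1_0(\mathcal T)$ is the Crouzeix–Raviart space of piecewise affine functions continuous at midpoints of interior edges and zero at midpoints of boundary edges; $\nabla_{NC}$ is the piecewise gradient; $u_{CR}\in CR^1_0(\mathcal T)$ satisfies $\int_\Omega\nabla_{NC}u_{CR}\cdot\nabla_{NC}v_{CR}\,dx=\int_\Omega fv_{CR}\,dx$ for all $v_{CR}\in CR^1_0(\mathcal T)$. For $K\in\mathcal T$, $\eta_{CR}^2(\mathcal T,K):=|K|\,\|f\|_{L^2(K)}^2+|K|^{1/2}\sum_{E\text{ edge of }K}\|[\partial u_{CR}/\partial s]_E\|_{L^2(E)}^2$, where $\partial/\partial s$ is the tangential derivative, $[\cdot]_E$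 the jump across an interior edge and the trace on a boundary edge; $\eta_{CR}^2(\mathcal T,\mathcal M):=\sum_{K\in\mathcal M}\eta_{CR}^2(\mathcal T,K)$ (analogously for $\hat{\mathcal T}$ with $\hat u_{CR}$). *)

(* Defs.v *)
From mathcomp Require Import all_boot all_order all_algebra.
From mathcomp Require Import all_classical all_reals all_analysis.
Import numFieldNormedType.Exports.
Import Order.TTheory GRing.Theory Num.Theory.

Set Implicit Arguments.
Unset Strict Implicit.
Unset Printing Implicit Defensive.

Local Open Scope ring_scope.
Local Open Scope classical_set_scope.

Section CrouzeixRaviart.
Variable R : realType.

Local Notation pt := (R * R)%type.

Definition pdot (x y : pt) : R := x.1 * y.1 + x.2 * y.2.
Definition psub (x y : pt) : pt := (x.1 - y.1, x.2 - y.2).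
Definition pmid (x y : pt) : pt := ((x.1 + y.1) / 2, (x.2 + y.2) / 2).
Definition edist (x y : pt) : R := Num.sqrt (pdot (psub x y) (psub x y)).
Definition prot (th : R) (x : pt) : pt :=
  (cos th * x.1 - sin th * x.2, sin th * x.1 + cos th * x.2).

Definition leb2 := ((@lebesgue_measure R) \x (@lebesgue_measure R))%E.

Definition lipschitz_domain (Om : set pt) : Prop :=
  open Om /\ connected Om /\ Om !=set0 /\
  (exists M : R, forall x, Om x -> `|x.1| <= M /\ `|x.2| <= M) /\
  forall z, (closure Om `\` Om) z ->
    exists (r th L : R) (phi : R -> R),
      0 < r /\ 0 <= L /\ (forall s t, `|phi s - phi t| <= L * `|s - t|) /\
      forall y, edist y z < r ->
        (Om y <-> (prot th (psub y z)).2 < phi (prot th (psub y z)).1).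

(* A (labelled) triangle (a, b, c): a is the newest vertex and the edge
   bc (opposite a) is the refinement edge for newest-vertex bisection. *)
Definition tri := (pt * pt * pt)%type.
Definition tv0 (K : tri) : pt := K.1.1.
Definition tv1 (K : tri) : pt := K.1.2.
Definition tv2 (K : tri) : pt := K.2.
Definition tverts (K : tri) : seq pt := [:: tv0 K; tv1 K; tv2 K].

Definition tri_hull (K : tri) : set pt :=
  [set x | exists l0 l1 l2 : R, [/\ 0 <= l0, 0 <= l1, 0 <= l2,
     l0 + l1 + l2 = 1 &
     x = (l0 * (tv0 K).1 + l1 * (tv1 K).1 + l2 * (tv2 K).1,
          l0 * (tv0 K).2 + l1 * (tv1 K).2 + l2 * (tv2 K).2)]].

Definition segment (p q : pt) : set pt :=
  [set x | exists t : R, [/\ 0 <= t, t <= 1 &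
     x = (p.1 + t * (q.1 - p.1), p.2 + t * (q.2 - p.2))]].

Definition tri_area (K : tri) : R :=
  let u := psub (tv1 K) (tv0 K) in let w := psub (tv2 K) (tv0 K) in
  `|u.1 * w.2 - u.2 * w.1| / 2.

Definition tedges (K : tri) : seq (pt * pt) :=
  [:: (tv0 K, tv1 K); (tv1 K, tv2 K); (tv2 K, tv0 K)].
Definition same_edge (E E' : pt * pt) : bool :=
  ((E.1 == E'.1) && (E.2 == E'.2)) || ((E.1 == E'.2) && (E.2 == E'.1)).
Definition has_edge (K : tri) (E : pt * pt) : bool := has (same_edge E) (tedges K).
Definition edge_length (E : pt * pt) : R := edist E.1 E.2.

Definition vangle (p q r : pt) : R :=
  acos (pdot (psub q p) (psub r p) / (edist q p * edist r p)).
Definition tangles (K : tri) : seq R :=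
  [:: vangle (tv0 K) (tv1 K) (tv2 K); vangle (tv1 K) (tv2 K) (tv0 K);
      vangle (tv2 K) (tv0 K) (tv1 K)].

Definition conforming (K K' : tri) : Prop :=
  tri_hull K `&` tri_hull K' = set0 \/
  (exists2 v, v \in tverts K & v \in tverts K' /\ tri_hull K `&` tri_hull K' = [set v]) \/
  (exists2 E, E \in tedges K & has_edge K' E /\
     tri_hull K `&` tri_hull K' = segment E.1 E.2).

Definition regular_triangulation (Om : set pt) (T : seq tri) : Prop :=
  [/\ uniq T,
      (forall K, K \in T -> 0 < tri_area K),
      closure Om = [set x | exists2 K, K \in T & tri_hull K x] &
      (forall K K', K \in T -> K' \in T -> K != K' -> conforming K K')].

Definition nvb_bisect (K : tri) : seq tri :=
  let m := pmid (tv1 K) (tv2 K) in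
  [:: (m, tv0 K, tv1 K); (m, tv2 K, tv0 K)].

Inductive nvb_reach (T0 : seq tri) : seq tri -> Prop :=
| nvb_base T : perm_eq T T0 -> nvb_reach T0 T
| nvb_step T K T' : nvb_reach T0 T -> K \in T ->
    perm_eq T' (rem K T ++ nvb_bisect K) -> nvb_reach T0 T'.

Definition admissible (Om : set pt) (T0 T : seq tri) : Prop :=
  nvb_reach T0 T /\ regular_triangulation Om T.

Definition refines (Th T : seq tri) : Prop :=
  forall Kh, Kh \in Th -> exists2 K, K \in T & tri_hull Kh `<=` tri_hull K.

(* An affine function x |-> c + g . x is stored as the pair (c, g); a
   piecewise affine function on T is a map from triangles to affine maps. *)
Definition affine := (R * pt)%type.
Definition affval (g : affine) (x : pt) : R := g.1 + pdot g.2 x.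

Definition is_CR (T : seq tri) (v : tri -> affine) : Prop :=
  (forall K K' E, K \in T -> K' \in T -> K != K' -> E \in tedges K ->
     has_edge K' E -> affval (v K) (pmid E.1 E.2) = affval (v K') (pmid E.1 E.2)) /\
  (forall K E, K \in T -> E \in tedges K ->
     (forall K', K' \in T -> K' != K -> ~~ has_edge K' E) ->
     affval (v K) (pmid E.1 E.2) = 0).

Definition locate (T : seq tri) (x : pt) : seq tri :=
  [seq K <- T | `[< tri_hull K x >]].
(* pointwise value and piecewise gradient (well defined up to the
   null set of edges) *)
Definition pwval (T : seq tri) (v : tri -> affine) (x : pt) : R :=
  if locate T x is K :: _ then affval (v K) x else 0.
Definition gradNC (T : seq tri) (v : tri -> affine) (x : pt) : pt :=
  if locate T x is K :: _ then (v K).2 else (0, 0).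

Definition L2 (Om : set pt) (f : pt -> R) : Prop :=
  measurable_fun Om f /\ (\int[leb2]_(x in Om) ((f x) ^+ 2)%:E < +oo)%E.

Definition CR_solution (Om : set pt) (f : pt -> R) (T : seq tri) (u : tri -> affine) : Prop :=
  is_CR T u /\
  forall v, is_CR T v ->
    Rintegral leb2 Om (fun x => pdot (gradNC T u x) (gradNC T v x)) =
    Rintegral leb2 Om (fun x => f x * pwval T v x).

(* the tangential derivative of u along E (unit tangent (q-p)/|E|);
   jump across an interior edge, trace on a boundary edge *)
Definition tjump (T : seq tri) (u : tri -> affine) (K : tri) (E : pt * pt) : R :=
  let t := psub E.2 E.1 in
  if [seq K' <- T | (K' != K) && has_edge K' E] is K' :: _
  then pdot (psub (u K).2 (u K').2) t / edge_length E
  else pdot (u K).2 t / edge_length E.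

Definition eta2 (f : pt -> R) (T : seq tri) (u : tri -> affine) (K : tri) : R :=
  tri_area K * Rintegral leb2 (tri_hull K) (fun x => f x ^+ 2) +
  Num.sqrt (tri_area K) *
    \sum_(E <- tedges K) edge_length E * tjump T u K E ^+ 2
    (* = || [du/ds]_E ||^2_{L^2(E)}, the jump being constant on E *).

Definition eta_common (f : pt -> R) (T : seq tri) (u : tri -> affine) (T' : seq tri) : R :=
  Num.sqrt (\sum_(K <- T | has (fun K' => `[< tri_hull K' = tri_hull K >]) T')
              eta2 f T u K).

Definition energy_diff (Om : set pt) (T : seq tri) (u : tri -> affine)
    (Th : seq tri) (uh : tri -> affine) : R :=
  Num.sqrt (Rintegral leb2 Om (fun x =>
    let d := psub (gradNC T u x) (gradNC Th uh x) in pdot d d)).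

Definition Lambda1 (w0 : R) : R :=
  Num.sqrt (48 * (cos w0 / sin w0) / Num.sqrt (2 * sin w0)).

End CrouzeixRaviart.

(* Main.v *)
(** The jump of [u - uh] across an edge [E] of a common triangle [K] involves only
    the gradients of [u - uh] on [K] and on the fine triangle [K2] across [E], since
    the coarse neighbour of [K] contains [K2]. Hence the reverse triangle inequality
    in [l^2] (the volume terms coincide) reduces the claim to bounding
    [|K|^(1/2) |E| |g|^2] for these two gradients [g], and the angle condition gives
    [|K|^(1/2) <= |E| (2 sin w0)^(-1/2)] and [|E|^2 <= 4 cot(w0) |K'|] for every
    triangle [K'] with edge [E]. Each fine triangle is met at most three times as
    [K] and three times as [K2]; with the factor 2 from [|a - b|^2 <= 2 |a|^2 + 2 |b|^2]
    this is the constant 48 = 2 * 4 * 6. *)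

Require Import Defs.
From mathcomp Require Import all_boot all_order all_algebra.
From mathcomp Require Import all_classical all_reals all_analysis.
From mathcomp Require Import measurable_realfun ring lra.
Import numFieldNormedType.Exports.
Import Order.TTheory GRing.Theory Num.Theory.
Local Open Scope ring_scope.
Local Open Scope classical_set_scope.

(** A mesh is a list of labelled triangles without adjacency data, and [conforming] only describes
    how two hulls intersect. The correspondence between the neighbours across [E] in the two meshes
    therefore has to be recovered from point sets. The midpoint of [E] is the tool: it is no vertex
    and lies on no other edge of its triangle, so a conforming triangle that contains it must share
    all of [E]. In one direction, the parent of the fine neighbour contains this midpoint. In the
    other, both meshes cover the closure of [Om], so a fine triangle is found close to the midpoint
    on the far side of [E]. Boundary edges are thereby matched with boundary edges. A second
    obstacle is that the energy is an integral over [Om], while the triangles cover its closure. The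
    Lipschitz boundary forces the open triangles into [Om], and their areas are compared with
    Lebesgue measure by slicing. *)

Lemma perm_eq3_ind (X : eqType) (P : X -> X -> X -> Prop) (a b c p q r : X) :
  (forall x y z, P x y z -> P y x z) -> (forall x y z, P x y z -> P y z x) ->
  perm_eq [:: p; q; r] [:: a; b; c] -> P a b c -> P p q r.
Proof.
move=> sw rot pe Pabc.
have perm2 x y z t : perm_eq [:: x; y] [:: z; t] ->
    (x = z /\ y = t) \/ (x = t /\ y = z).
  move=> h; have : x \in [:: z; t] by rewrite -(perm_mem h) mem_head.
  rewrite !inE => /orP[] /eqP e; subst x.
    by left; move: h; rewrite perm_cons => /perm_small_eq -/(_ isT)[].
  right; move: h; rewrite perm_sym -[X in perm_eq X _]/([:: z] ++ [:: t]).
  by rewrite perm_catC perm_cons perm_sym => /perm_small_eq -/(_ isT)[].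
have : p \in [:: a; b; c] by rewrite -(perm_mem pe) mem_head.
rewrite !inE => /or3P[] /eqP e; subst p.
- move: pe; rewrite perm_cons => /perm2[] [-> ->] //.
  by apply/rot/sw.
- move: pe; rewrite perm_sym -[X in perm_eq X _]/([:: a] ++ [:: b] ++ [:: c]).
  rewrite perm_catCA /= perm_cons perm_sym => /perm2[] [-> ->].
    exact: sw.
  exact: rot.
- move: pe; rewrite perm_sym -[X in perm_eq X _]/([:: a; b] ++ [:: c]).
  rewrite perm_catC /= perm_cons perm_sym => /perm2[] [-> ->].
    by apply/rot/rot.
  by apply/sw/rot.
Qed.

(** * Barycentric geometry of triangles *)

Section Geometry.
Set Implicit Arguments.
Unset Strict Implicit.
Variable R : realType.
Local Notation pt := (R * R)%type.
Local Notation edist := Defs.edist.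
Implicit Types (p q r x : pt) (K : tri R).

Definition orient p q r : R :=
  (q.1 - p.1) * (r.2 - p.2) - (q.2 - p.2) * (r.1 - p.1).

(** The barycentric coordinate of [x] at [p], as a quotient of signed areas; cycling the arguments
    gives those at [q] and [r]. *)
Definition bary p q r x : R := orient x q r / orient p q r.

Definition combo (l0 l1 l2 : R) p q r : pt :=
  (l0 * p.1 + l1 * q.1 + l2 * r.1, l0 * p.2 + l1 * q.2 + l2 * r.2).

(** For a degenerate triangle the denominators are 0, so all three coordinates are 0 and the set is
    empty. *)
Definition tri_int K : set pt := [set x | [/\ 0 < bary (tv0 K) (tv1 K) (tv2 K) x,
  0 < bary (tv1 K) (tv2 K) (tv0 K) x & 0 < bary (tv2 K) (tv0 K) (tv1 K) x]].

Lemma orient_cycle p q r : orient q r p = orient p q r.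
Proof. by rewrite /orient; ring. Qed.

Lemma orient_swap p q r : orient q p r = - orient p q r.
Proof. by rewrite /orient; ring. Qed.

Lemma orient_combo l0 l1 l2 p q r a b : l0 + l1 + l2 = 1 ->
  orient (combo l0 l1 l2 p q r) a b =
  l0 * orient p a b + l1 * orient q a b + l2 * orient r a b.
Proof.
move=> e; have -> : l0 = 1 - l1 - l2 by rewrite -e; ring.
by rewrite /orient /combo /=; ring.
Qed.

Lemma orientppr p r : orient p p r = 0. Proof. by rewrite /orient; ring. Qed.
Lemma orientprr p r : orient p r r = 0. Proof. by rewrite /orient; ring. Qed.
Lemma orientprp p r : orient p r p = 0. Proof. by rewrite /orient; ring. Qed.
Definition orient0 := (orientppr, orientprr, orientprp).

Lemma tri_area_orient K : tri_area K = `|orient (tv0 K) (tv1 K) (tv2 K)| / 2.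
Proof. by []. Qed.

Lemma area_gt0 p q r : (0 < tri_area (p, q, r)) = (orient p q r != 0).
Proof. by rewrite tri_area_orient /= pmulr_lgt0 ?normr_gt0 // invr_gt0 ltr0n. Qed.

Lemma bary_combo l0 l1 l2 p q r : orient p q r != 0 -> l0 + l1 + l2 = 1 ->
  [/\ bary p q r (combo l0 l1 l2 p q r) = l0,
      bary q r p (combo l0 l1 l2 p q r) = l1 &
      bary r p q (combo l0 l1 l2 p q r) = l2].
Proof.
move=> D e; have D1 : orient q r p != 0 by rewrite orient_cycle.
have D2 : orient r p q != 0 by rewrite -orient_cycle.
rewrite /bary !orient_combo // !orient0.
by rewrite !mulr0 !addr0 !add0r; split; rewrite mulfK.
Qed.

Lemma bary_sum p q r x : orient p q r != 0 ->
  bary p q r x + bary q r p x + bary r p q x = 1.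
Proof.
move=> D; rewrite /bary -[orient r p q]orient_cycle ![orient q r p]orient_cycle.
rewrite -!mulrDl; apply: (canLR (mulfK D)); rewrite mul1r /orient; ring.
Qed.

Lemma combo_bary p q r x : orient p q r != 0 ->
  x = combo (bary p q r x) (bary q r p x) (bary r p q x) p q r.
Proof.
move=> D; rewrite /bary -[orient r p q]orient_cycle ![orient q r p]orient_cycle.
move: D; rewrite /combo /orient; case: x p q r => [x1 x2] [p1 p2] [q1 q2] [r1 r2] /= D.
by congr (_, _); field.
Qed.

Lemma tri_hullP p q r x : orient p q r != 0 ->
  tri_hull (p, q, r) x <->
  [/\ 0 <= bary p q r x, 0 <= bary q r p x & 0 <= bary r p q x].
Proof.
move=> D; split=> [[l0 [l1 [l2 [h0 h1 h2 e xe]]]]|[h0 h1 h2]].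
  by have := bary_combo D e; rewrite /combo -xe => -[-> -> ->].
exists (bary p q r x), (bary q r p x), (bary r p q x); split => //.
  exact: bary_sum.
exact: combo_bary.
Qed.

Lemma tri_intP p q r x : orient p q r != 0 ->
  tri_int (p, q, r) x <->
  exists l0 l1 l2, [/\ 0 < l0, 0 < l1, 0 < l2, l0 + l1 + l2 = 1 & x = combo l0 l1 l2 p q r].
Proof.
move=> D; split=> [[/= h0 h1 h2]|[l0 [l1 [l2 [h0 h1 h2 e xe]]]]].
  exists (bary p q r x), (bary q r p x), (bary r p q x); split => //.
    exact: bary_sum.
  exact: combo_bary.
by rewrite /tri_int /=; have := bary_combo D e; rewrite -xe => -[-> -> ->].
Qed.

Lemma tri_int_hull K x : 0 < tri_area K -> tri_int K x -> tri_hull K x.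
Proof.
case: K => [[p q] r]; rewrite area_gt0 => D /= [h0 h1 h2].
by apply/tri_hullP => //; split; apply: ltW.
Qed.

(** A transposition and a rotation generate all permutations of three vertices, so invariance under
    relabelling is checked for two relabellings instead of six. *)
Lemma perm_verts (P : tri R -> Prop) K p q r :
  (forall x y z, P (x, y, z) -> P (y, x, z)) ->
  (forall x y z, P (x, y, z) -> P (y, z, x)) ->
  perm_eq [:: p; q; r] (tverts K) -> P K -> P (p, q, r).
Proof.
case: K => [[a b] c] sw rot pe.
exact: (perm_eq3_ind _ (fun x y z => P (x, y, z)) a b c).
Qed.

Lemma perm_hull K p q r :
  perm_eq [:: p; q; r] (tverts K) -> tri_hull (p, q, r) = tri_hull K.
Proof.
move=> pe; apply: (perm_verts (P := fun K' => tri_hull K' = tri_hull K) _ _ pe) => // x y z <-;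
  apply/seteqP; split=> w [l0 [l1 [l2 [h0 h1 h2 e we]]]].
- by exists l1, l0, l2; split=> //; rewrite ?we -?e /=; [ring|congr (_, _); ring].
- by exists l1, l0, l2; split=> //; rewrite ?we -?e /=; [ring|congr (_, _); ring].
- by exists l2, l0, l1; split=> //; rewrite ?we -?e /=; [ring|congr (_, _); ring].
- by exists l1, l2, l0; split=> //; rewrite ?we -?e /=; [ring|congr (_, _); ring].
Qed.

Lemma bary_swap p q r x : bary p r q x = bary p q r x.
Proof.
have e a : orient a r q = - orient a q r by rewrite /orient; ring.
by rewrite /bary !e invrN mulrNN.
Qed.

Lemma perm_int K p q r :
  perm_eq [:: p; q; r] (tverts K) -> tri_int (p, q, r) = tri_int K.
Proof.
move=> pe; apply: (perm_verts (P := fun K' => tri_int K' = tri_int K) _ _ pe) => // x y z <-;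
  rewrite /tri_int /=; apply/seteqP; split=> w /= [h1 h2 h3];
  by split=> //; rewrite bary_swap.
Qed.

Lemma perm_area K p q r :
  perm_eq [:: p; q; r] (tverts K) -> tri_area (p, q, r) = tri_area K.
Proof.
move=> pe; apply: (perm_verts (P := fun K' => tri_area K' = tri_area K) _ _ pe) => // x y z <-;
  rewrite !tri_area_orient /=; last by rewrite orient_cycle.
by rewrite orient_swap normrN.
Qed.

Lemma vert_mem_hull K v : v \in tverts K -> tri_hull K v.
Proof.
case: K => [[p q] r]; rewrite !inE => /or3P[] /eqP ->.
- by exists 1, 0, 0; split=> //=; rewrite ?addr0 // !mul1r !mul0r !addr0; case: (p).
- by exists 0, 1, 0; split=> //=; rewrite ?addr0 ?add0r // !mul1r !mul0r !addr0 !add0r; case: (q).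
- by exists 0, 0, 1; split=> //=; rewrite ?addr0 ?add0r // !mul1r !mul0r !add0r; case: (r).
Qed.

(* A vertex of one triangle is an extreme point of their common hull. *)
Lemma vert_hull p q r K : orient p q r != 0 ->
  tri_hull K = tri_hull (p, q, r) -> p \in tverts K.
Proof.
case: K => [[a b] c] D e.
have hp : tri_hull (a, b, c) p.
  by rewrite e; apply/tri_hullP => //; rewrite /bary !orient0 !mul0r divff.
have vx w : tri_hull (a, b, c) w -> bary p q r w <= 1 /\ (bary p q r w = 1 -> w = p).
  rewrite e => /tri_hullP -/(_ D)[h0 h1 h2]; have s := bary_sum w D.
  split=> [|h]; first lra.
  rewrite (combo_bary w D) h.
  have -> : bary q r p w = 0 by lra.
  have -> : bary r p q w = 0 by lra.
  by rewrite /combo !mul1r !mul0r !addr0; case: (p).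
have ha : tri_hull (a, b, c) a by apply: vert_mem_hull; rewrite !inE eqxx.
have hb : tri_hull (a, b, c) b by apply: vert_mem_hull; rewrite !inE eqxx orbT.
have hc : tri_hull (a, b, c) c by apply: vert_mem_hull; rewrite !inE eqxx !orbT.
case: hp => l0 [l1 [l2 [h0 h1 h2 s pe]]].
have : bary p q r p = 1 by rewrite /bary divff.
rewrite {2}[p]pe -[X in bary _ _ _ X]/(combo l0 l1 l2 a b c) /bary orient_combo // !mulrDl -!mulrA.
rewrite -![_ / orient p q r]/(bary p q r _) /=.
have [la ea] := vx _ ha; have [lb eb] := vx _ hb; have [lc ec] := vx _ hc.
move=> s1; rewrite !inE.
(* The values of [bary p q r] at [a], [b], [c] are at most 1 and their weighted mean is 1, so a
   vertex with nonzero weight has value 1 and equals [p]. *)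
have [l00|l00] := eqVneq l0 0; last by rewrite ea ?eqxx //; nra.
have [l10|l10] := eqVneq l1 0; last by rewrite eb ?eqxx ?orbT //; nra.
by rewrite ec ?eqxx ?orbT //; nra.
Qed.

(** The right side is the determinant of the unnormalised barycentric coordinates of [a], [b], [c]
    relative to [p], [q], [r], expanded along the coordinate at [p]. It shows that three points on
    the line [q r] span no area. *)
Lemma orient_det p q r a b c : orient p q r ^+ 2 * orient a b c =
  orient a q r * (orient b r p * orient c p q - orient c r p * orient b p q) -
  orient b q r * (orient a r p * orient c p q - orient c r p * orient a p q) +
  orient c q r * (orient a r p * orient b p q - orient b r p * orient a p q).
Proof. by rewrite /orient; ring. Qed.

Lemma bary_comboE p q r (l0 l1 l2 : R) a b c : l0 + l1 + l2 = 1 ->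
  bary p q r (combo l0 l1 l2 a b c) =
  l0 * bary p q r a + l1 * bary p q r b + l2 * bary p q r c.
Proof. by move=> e; rewrite /bary orient_combo; [ring|]. Qed.

(** The coordinate is affine and nonnegative at the vertices of [K], hence a positive combination of
    nonnegative numbers at [x]. It could vanish only by vanishing at all three vertices, and then
    [orient_det] would make [K] degenerate. *)
Lemma bary_int_gt0 p q r K x : orient p q r != 0 -> 0 < tri_area K ->
  (forall v, v \in tverts K -> 0 <= bary p q r v) ->
  tri_int K x -> 0 < bary p q r x.
Proof.
case: K => [[a b] c] D; rewrite area_gt0 => A h.
case/(tri_intP _ A) => l0 [l1 [l2 [h0 h1 h2 e ->]]].
rewrite bary_comboE //.
have ha : 0 <= bary p q r a by apply: h; rewrite !inE eqxx.
have hb : 0 <= bary p q r b by apply: h; rewrite !inE eqxx orbT.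
have hc : 0 <= bary p q r c by apply: h; rewrite !inE eqxx !orbT.
have [a0|a0] := eqVneq (bary p q r a) 0; last first.
  have pa : 0 < bary p q r a by rewrite lt0r a0.
  have := mulr_gt0 h0 pa.
  have := mulr_ge0 (ltW h1) hb; have := mulr_ge0 (ltW h2) hc; lra.
have [b0|b0] := eqVneq (bary p q r b) 0; last first.
  have pb : 0 < bary p q r b by rewrite lt0r b0.
  have := mulr_gt0 h1 pb.
  have := mulr_ge0 (ltW h0) ha; have := mulr_ge0 (ltW h2) hc; lra.
have [c0|c0] := eqVneq (bary p q r c) 0; last first.
  have pc : 0 < bary p q r c by rewrite lt0r c0.
  have := mulr_gt0 h2 pc.
  have := mulr_ge0 (ltW h0) ha; have := mulr_ge0 (ltW h1) hb; lra.
have := orient_det p q r a b c.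
have z v : bary p q r v = 0 -> orient v q r = 0.
  by move/eqP; rewrite /bary mulf_eq0 invr_eq0 (negbTE D) orbF => /eqP.
rewrite (z a a0) (z b b0) (z c c0) !mul0r subrr addr0 => /eqP.
by rewrite mulf_eq0 (negbTE A) orbF sqrf_eq0 (negbTE D).
Qed.

Lemma tri_int_subset K K' : 0 < tri_area K -> 0 < tri_area K' ->
  tri_hull K' `<=` tri_hull K -> tri_int K' `<=` tri_int K.
Proof.
case: K => [[p q] r]; rewrite area_gt0 => D A sub x ix.
have h v : v \in tverts K' -> _ := fun hv => proj1 (tri_hullP v D) (sub _ (vert_mem_hull hv)).
split; rewrite /=.
- by apply: bary_int_gt0 ix => // v /h[].
- by apply: bary_int_gt0 ix => //; [rewrite orient_cycle|move=> v /h[]].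
- by apply: bary_int_gt0 ix => //; [rewrite -orient_cycle|move=> v /h[]].
Qed.

Lemma tri_int_nonempty K : 0 < tri_area K -> exists x, tri_int K x.
Proof.
case: K => [[p q] r]; rewrite area_gt0 => D.
exists (combo 3^-1 3^-1 3^-1 p q r); apply/(tri_intP _ D).
by exists 3^-1, 3^-1, 3^-1; split=> //; lra.
Qed.

Lemma edge_not_int K E x : E \in tedges K -> segment E.1 E.2 x -> ~ tri_int K x.
Proof.
case: K => [[p q] r] h [t [_ _ ->]] [/=].
rewrite /bary; move: h; rewrite !inE => /or3P[] /eqP -> /= h1 h2 h3.
- move: h3; set o := orient _ p q; suff -> : o = 0 by rewrite mul0r ltxx.
  by rewrite /o /orient /=; ring.
- move: h1; set o := orient _ q r; suff -> : o = 0 by rewrite mul0r ltxx.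
  by rewrite /o /orient /=; ring.
- move: h2; set o := orient _ r p; suff -> : o = 0 by rewrite mul0r ltxx.
  by rewrite /o /orient /=; ring.
Qed.

(** The intersection is empty, a vertex of [K] or an edge of [K], and on the last two some
    barycentric coordinate of [K] is 0. *)
Lemma conforming_int K K' x : conforming K K' -> tri_hull K' x -> 0 < tri_area K ->
  ~ tri_int K x.
Proof.
move=> C hx A ix; have hK := tri_int_hull A ix.
have hI : (tri_hull K `&` tri_hull K') x by split.
case: C => [e|[[v vK [_ e]]|[E EK [_ e]]]]; rewrite e in hI => //.
- rewrite /= in hI; subst x; case: K vK ix {A hK e} => [[p q] r] + [/=].
  by rewrite !inE /bary => /or3P[] /eqP -> ; rewrite !orient0 !mul0r ltxx.
- exact: edge_not_int EK hI ix.
Qed.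

(** * Edges, their midpoints and the neighbours across them *)

Lemma same_edgeC (E F : pt * pt) : same_edge E F = same_edge F E.
Proof.
rewrite /same_edge !(eq_sym F.1) !(eq_sym F.2) andbC.
by congr orb; rewrite andbC.
Qed.

Lemma same_edge_rev (E F : pt * pt) : same_edge E (F.2, F.1) = same_edge E F.
Proof. by rewrite /same_edge /= orbC. Qed.

Lemma same_edgeP (E F : pt * pt) : same_edge E F -> E = F \/ E = (F.2, F.1).
Proof.
case: E F => [a b] [c d] /=.
by case/orP => /= /andP[/eqP-> /eqP->]; [left|right].
Qed.

Lemma perm_has_edge K p q r E :
  perm_eq [:: p; q; r] (tverts K) -> has_edge (p, q, r) E = has_edge K E.
Proof.
move=> pe; apply: (perm_verts (P := fun K' => has_edge K' E = has_edge K E) _ _ pe) => // x y z <-;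
  rewrite /has_edge /tedges /=.
- rewrite -(same_edge_rev E (y, x)) -(same_edge_rev E (x, z)) -(same_edge_rev E (z, y)) /=.
  by do !case: same_edge.
- by do !case: same_edge.
Qed.

Lemma same_has_edge K E F : same_edge E F -> has_edge K E = has_edge K F.
Proof.
case/same_edgeP => -> //; apply: eq_has => e.
by rewrite same_edgeC same_edge_rev same_edgeC.
Qed.

Lemma tedge_has_edge K E : E \in tedges K -> has_edge K E.
Proof.
by move=> h; apply/hasP; exists E => //; rewrite /same_edge !eqxx.
Qed.

(** A normal form for arguments about an edge: its ends become the first two vertices and the
    opposite vertex the third. *)
Lemma has_edge_perm K E : has_edge K E ->
  exists r, perm_eq [:: E.1; E.2; r] (tverts K).
Proof.
case: K => [[p q] r]; rewrite /tverts /=.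
have pC (a b c : pt) : perm_eq [:: a; b; c] [:: b; a; c].
  by apply/permPl; exact: (perm_catCA [:: a] [:: b] [:: c]).
have pR (a b c : pt) : perm_eq [:: a; b; c] [:: b; c; a].
  by apply/permPl; exact: (perm_catC [:: a] [:: b; c]).
have pRR a b c := perm_trans (pR a b c) (pR b c a).
have pS a b c := perm_trans (pC a b c) (pR b a c).
have pSR a b c := perm_trans (pC a b c) (pRR b a c).
by case/or4P => // /same_edgeP [] -> /=;
  [exists r|exists r|exists p|exists p|exists q|exists q]; rewrite ?pC ?pR ?pRR ?pS ?pSR.
Qed.

Lemma perm_edge K p q r : perm_eq [:: p; q; r] (tverts K) -> has_edge K (p, q).
Proof. by move=> /perm_has_edge <-; rewrite tedge_has_edge // mem_head. Qed.

Lemma pmid_combo p q r : pmid p q = combo 2^-1 2^-1 0 p q r.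
Proof. by rewrite /pmid /combo; congr (_, _); field. Qed.

(** If the midpoint of [E] lay on another edge, which joins [r] to one end of [E], then that line
    would also contain the other end, and the triangle would be degenerate. *)
Lemma mid_edge K E F : 0 < tri_area K -> has_edge K E -> has_edge K F ->
  segment F.1 F.2 (pmid E.1 E.2) -> same_edge F E.
Proof.
move=> A /has_edge_perm[r pe]; rewrite -(perm_has_edge F pe).
move: A; rewrite -(perm_area pe) area_gt0 => D.
set m := pmid _ _ => + [t [_ _ mF]].
have m2 : E.1.1 + E.2.1 = 2 * m.1 /\ E.1.2 + E.2.2 = 2 * m.2 by rewrite /m /pmid /=; split; field.
have {}mF : m.1 = F.1.1 + t * (F.2.1 - F.1.1) /\ m.2 = F.1.2 + t * (F.2.2 - F.1.2) by rewrite mF.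
move: m2 mF => [m1 m2] [f1 f2].
rewrite /has_edge /= => /or4P[] // h.
all: exfalso; move/eqP: D; apply; rewrite /orient.
- have [u [g1 g2]] : exists u, m.1 = E.2.1 + u * (r.1 - E.2.1) /\ m.2 = E.2.2 + u * (r.2 - E.2.2).
    by case/same_edgeP: h f1 f2 => -> /= -> ->; [exists t|exists (1 - t)]; split; ring.
  have -> : E.1.1 = 2 * (E.2.1 + u * (r.1 - E.2.1)) - E.2.1 by lra.
  have -> : E.1.2 = 2 * (E.2.2 + u * (r.2 - E.2.2)) - E.2.2 by lra.
  by ring.
- have [u [g1 g2]] : exists u, m.1 = E.1.1 + u * (r.1 - E.1.1) /\ m.2 = E.1.2 + u * (r.2 - E.1.2).
    by case/same_edgeP: h f1 f2 => -> /= -> ->; [exists (1 - t)|exists t]; split; ring.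
  have -> : E.2.1 = 2 * (E.1.1 + u * (r.1 - E.1.1)) - E.1.1 by lra.
  have -> : E.2.2 = 2 * (E.1.2 + u * (r.2 - E.1.2)) - E.1.2 by lra.
  by ring.
Qed.

(* If the opposite vertices lay on the same side of the common edge, the
   points close to its midpoint would be interior to both triangles. *)
Lemma opposite_sides p q r r' K K' :
  0 < tri_area K -> 0 < tri_area K' ->
  perm_eq [:: p; q; r] (tverts K) -> perm_eq [:: p; q; r'] (tverts K') ->
  (forall x, tri_hull K' x -> ~ tri_int K x) ->
  orient p q r * orient p q r' < 0.
Proof.
move=> A A' pe pe' dis; move: A A' dis.
rewrite -(perm_area pe) -(perm_area pe') -(perm_hull pe') -(perm_int pe) !area_gt0.
move=> D D' dis; rewrite ltNge; apply/negP; rewrite le_eqVlt eq_sym mulf_eq0.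
rewrite (negbTE D) (negbTE D') /= => s.
have d3 : 0 < bary r' p q r.
  rewrite /bary; have -> : orient r p q = orient p q r by rewrite /orient; ring.
  have -> : orient r' p q = orient p q r' by rewrite /orient; ring.
  have -> : orient p q r / orient p q r' = orient p q r * orient p q r' / orient p q r' ^+ 2 by field.
  by rewrite divr_gt0 // exprn_even_gt0.
pose A := bary p q r' r; pose B := bary q r' p r.
(* Small enough that the coordinates [(1 - e) / 2 + e * A] and [(1 - e) / 2 + e * B] of [x] relative
   to [(p, q, r')] stay nonnegative, whatever the signs of [A] and [B]. *)
pose e := (2 * (1 + `|A| + `|B|))^-1.
have AB : 0 < 2 * (1 + `|A| + `|B|) by have := normr_ge0 A; have := normr_ge0 B; lra.
have e0 : 0 < e by rewrite invr_gt0.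
have eE : e * (2 * (1 + `|A| + `|B|)) = 1 by rewrite mulVf ?gt_eqF.
have eA : - (e * A) <= e * `|A| by rewrite -mulrN ler_pM2l // -normrN ler_norm.
have eB : - (e * B) <= e * `|B| by rewrite -mulrN ler_pM2l // -normrN ler_norm.
have nA : 0 <= e * `|A| by rewrite mulr_ge0 // ltW.
have nB : 0 <= e * `|B| by rewrite mulr_ge0 // ltW.
pose x := combo ((1 - e) / 2) ((1 - e) / 2) e p q r.
have ix : tri_int (p, q, r) x.
  by apply/(tri_intP _ D); exists ((1 - e) / 2), ((1 - e) / 2), e; split=> //; lra.
apply: dis ix; apply/(tri_hullP _ D').
have e1 : (1 - e) / 2 + (1 - e) / 2 + e = 1 by field.
have [/= Dp Dq Dr] : [/\ bary p q r' p = 1, bary q r' p q = 1 & bary r' p q p = 0].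
  by rewrite /bary !orient0 mul0r !divff // orient_cycle.
have [E1 E2 E3] : [/\ bary p q r' q = 0, bary q r' p p = 0 & bary r' p q q = 0].
  by rewrite /bary !orient0 !mul0r.
by rewrite /x !bary_comboE // Dp Dq Dr E1 E2 E3 -/A -/B; split; [lra|lra|];
  rewrite !mulr0 !add0r mulr_ge0 // ltW.
Qed.

Lemma neighbour_unique Om (T : seq (tri R)) K K2 K3 E :
  regular_triangulation Om T -> K \in T -> K2 \in T -> K3 \in T ->
  K2 != K -> K3 != K -> has_edge K E -> has_edge K2 E -> has_edge K3 E -> K2 = K3.
Proof.
move=> [_ A _ C] k k2 k3 n2 n3 h h2 h3; apply/eqP/negP => /negP n23.
have [r pe] := has_edge_perm h; have [r2 pe2] := has_edge_perm h2.
have [r3 pe3] := has_edge_perm h3.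
have dis K1 K' : K1 \in T -> K' \in T -> K1 != K' -> forall x, tri_hull K' x -> ~ tri_int K1 x.
  by move=> a b n x /conforming_int; apply; [exact: C|exact: A].
have := opposite_sides (A _ k2) (A _ k) pe2 pe (dis _ _ k2 k n2).
have := opposite_sides (A _ k3) (A _ k) pe3 pe (dis _ _ k3 k n3).
have := opposite_sides (A _ k2) (A _ k3) pe2 pe3 (dis _ _ k2 k3 n23).
set a := orient _ _ r2; set b := orient _ _ r3; set c := orient _ _ r.
move=> ab bc ac; have : 0 < (a * b) * (b * c) by rewrite nmulr_rgt0.
by have := mulr_ge0_le0 (sqr_ge0 b) (ltW ac); lra.
Qed.

(** The vertices are the extreme points of the hull, so the set determines them; it says nothing
    about the labelling, hence only a permutation. *)
Lemma hull_eq_verts K K' : 0 < tri_area K -> 0 < tri_area K' ->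
  tri_hull K = tri_hull K' -> perm_eq (tverts K) (tverts K').
Proof.
case: K => [[p q] r]; rewrite area_gt0 => D A e.
have D1 : orient q r p != 0 by rewrite orient_cycle.
have D2 : orient r p q != 0 by rewrite -orient_cycle.
have u : uniq (tverts (p, q, r)).
  rewrite /tverts /tv0 /tv1 /tv2 /= !inE !andbT negb_or -andbA; apply/and3P; split;
  by apply: contra_neq D => ->; rewrite orient0.
have s : {subset tverts (p, q, r) <= tverts K'}.
  move=> v; rewrite {1}/tverts 3!inE => /or3P[] /eqP ->.
  - exact: vert_hull D (esym e).
  - apply: vert_hull D1 _; rewrite -e; symmetry; apply: perm_hull.
    by apply/permPl; exact: (perm_catC [:: q; r] [:: p]).
  - apply: vert_hull D2 _; rewrite -e; symmetry; apply: perm_hull.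
    by apply/permPl; exact: (perm_catC [:: r] [:: p; q]).
apply: uniq_perm => //; first exact: leq_size_uniq u s _.
by case: (uniq_min_size u s).
Qed.

(** An interior point of [Kh] is interior to [K] and lies in [K'], which conformity forbids for
    distinct triangles. *)
Lemma parent_unique Om (T : seq (tri R)) Kh K K' :
  regular_triangulation Om T -> 0 < tri_area Kh -> K \in T -> K' \in T ->
  tri_hull Kh `<=` tri_hull K -> tri_hull Kh `<=` tri_hull K' -> K = K'.
Proof.
move=> [_ A _ C] a k k' s s'; apply/eqP/negP => /negP n.
have [x ix] := tri_int_nonempty a.
apply: (conforming_int (C _ _ k k' n) _ (A _ k)); last exact: tri_int_subset (A _ k) a s _ ix.
exact/s'/tri_int_hull.
Qed.

Lemma has_edge_neq K E : 0 < tri_area K -> has_edge K E -> E.1 != E.2.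
Proof.
move=> A /has_edge_perm[r pe]; move: A; rewrite -(perm_area pe) area_gt0.
by apply: contra_neq => ->; rewrite orient0.
Qed.

Lemma mid_hull K E : 0 < tri_area K -> has_edge K E -> tri_hull K (pmid E.1 E.2).
Proof.
move=> A /has_edge_perm[r pe]; rewrite -(perm_hull pe) (pmid_combo _ _ r).
by exists 2^-1, 2^-1, 0; split; rewrite ?invr_ge0 ?ler0n // addr0; field.
Qed.

Lemma mid_not_vert K E : 0 < tri_area K -> has_edge K E -> pmid E.1 E.2 \notin tverts K.
Proof.
move=> A h; have n := has_edge_neq A h; have [r pe] := has_edge_perm h.
rewrite -(perm_mem pe) !inE; move: A; rewrite -(perm_area pe) area_gt0.
case: E n {h pe} => [[a b] [c d]] /= n D.
have z (s t : R) : (s + t) / 2 = s -> s = t by lra.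
have z' (s t : R) : (s + t) / 2 = t -> s = t by lra.
apply/negP => /or3P[] /eqP.
- by rewrite /pmid /= => -[/z e1 /z e2]; move: n; rewrite e1 e2 eqxx.
- by rewrite /pmid /= => -[/z' e1 /z' e2]; move: n; rewrite e1 e2 eqxx.
- by move=> e; move/eqP: D; apply; rewrite -e /orient /=; field.
Qed.

(** The midpoint rules out an empty intersection and a single vertex. What remains is an edge of [K]
    through the midpoint, and that edge is [E]. *)
Lemma conforming_edge K K' E : conforming K K' -> 0 < tri_area K -> has_edge K E ->
  tri_hull K' (pmid E.1 E.2) -> has_edge K' E.
Proof.
move=> C A h m'.
have : (tri_hull K `&` tri_hull K') (pmid E.1 E.2) by split=> //; exact: mid_hull.
case: C => [->//|[[v vK [_ ->]] mv|[F FK [h' ->]] mF]].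
- by have := mid_not_vert A h; rewrite mv vK.
- by rewrite -(same_has_edge _ (mid_edge A h (tedge_has_edge FK) mF)).
Qed.

(** The parent [K2] contains the midpoint of [E]. It differs from [K], since otherwise [K2h] would
    lie in the hull of [Kh]. *)
Lemma fine_neighbour Om (T Th : seq (tri R)) K Kh K2 K2h E :
  regular_triangulation Om T -> regular_triangulation Om Th ->
  K \in T -> Kh \in Th -> tri_hull K = tri_hull Kh -> has_edge K E ->
  K2 \in T -> K2h \in Th -> tri_hull K2h `<=` tri_hull K2 ->
  K2h != Kh -> has_edge K2h E -> K2 != K /\ has_edge K2 E.
Proof.
move=> [_ A _ C] rTh k kh e h k2 k2h s n h2.
have [_ Ah _ _] := rTh.
have n2 : K2 != K.
  apply: contra_neq n => e2; apply: (parent_unique rTh (Ah _ k2h)) => //.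
  by rewrite -e -e2.
split=> //; apply: (conforming_edge (C _ _ k k2 _) (A _ k) h); first by rewrite eq_sym.
exact/s/mid_hull/h2/Ah.
Qed.

(** Closedness of the hull along the segment from [x] to [y]: if [x] is outside, some coordinate is
    negative at [x] and stays negative for small parameters [e], so the premise fails there. *)
Lemma hull_limit K x y : 0 < tri_area K -> exists2 e0 : R, 0 < e0 &
  forall e, 0 < e -> e < e0 -> tri_hull K (combo (1 - e) e 0 x y y) -> tri_hull K x.
Proof.
case: K => [[p q] r]; rewrite area_gt0 => D.
have [h|h] := pselect (tri_hull (p, q, r) x); first by exists 1.
have D1 : orient q r p != 0 by rewrite orient_cycle.
have D2 : orient r p q != 0 by rewrite -orient_cycle.
have key a b c : bary a b c x < 0 -> exists2 e0 : R, 0 < e0 &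
    forall e, 0 < e -> e < e0 -> bary a b c (combo (1 - e) e 0 x y y) < 0.
  set u := bary _ _ _ x; set v := bary a b c y => u0.
  have vu : 0 < `|v - u| + 1 by have := normr_ge0 (v - u); lra.
  exists (- u / (`|v - u| + 1)); first by rewrite divr_gt0 // oppr_gt0.
  move=> e e0; rewrite ltr_pdivlMr // => l.
  rewrite bary_comboE; last by ring.
  have := ler_wpM2l (ltW e0) (ler_norm (v - u)); rewrite -/u -/v; lra.
have out a b c : (exists2 e0 : R, 0 < e0 &
    forall e, 0 < e -> e < e0 -> bary a b c (combo (1 - e) e 0 x y y) < 0) ->
    (forall z, tri_hull (p, q, r) z -> 0 <= bary a b c z) ->
    exists2 e0 : R, 0 < e0 & forall e, 0 < e -> e < e0 ->
     tri_hull (p, q, r) (combo (1 - e) e 0 x y y) -> tri_hull (p, q, r) x.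
  move=> [e0 e00 H] Z; exists e0 => // e h1 h2 /Z.
  by rewrite leNgt H.
have [b1|b1] := ltP (bary p q r x) 0.
  by apply: out (key _ _ _ b1) _ => z /(tri_hullP _ D)[].
have [b2|b2] := ltP (bary q r p x) 0.
  by apply: out (key _ _ _ b2) _ => z /(tri_hullP _ D)[].
have [b3|b3] := ltP (bary r p q x) 0.
  by apply: out (key _ _ _ b3) _ => z /(tri_hullP _ D)[].
by case: h; apply/tri_hullP.
Qed.

Lemma hull_limit_seq (s : seq (tri R)) x y : (forall K, K \in s -> 0 < tri_area K) ->
  exists2 e0 : R, 0 < e0 & forall e K, 0 < e -> e < e0 -> K \in s ->
    tri_hull K (combo (1 - e) e 0 x y y) -> tri_hull K x.
Proof.
elim: s => [|K s IH] A; first by exists 1.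
have [|e1 h1 H1] := IH; first by move=> K' h; apply: A; rewrite inE h orbT.
have [e2 h2 H2] := @hull_limit K x y (A _ (mem_head _ _)).
exists (Num.min e1 e2); first by rewrite lt_min h1 h2.
move=> e K' e0; rewrite lt_min => /andP[l1 l2]; rewrite inE => /orP[/eqP->|k].
  exact: H2.
exact: H1.
Qed.

(** Points on the median of [K2] near the midpoint of [E] are interior to [K2], hence outside [K],
    and some fine triangle contains them. Close enough to the midpoint, that triangle contains the
    midpoint as well and so has the edge [E]. *)
Lemma coarse_neighbour Om (T Th : seq (tri R)) K Kh K2 E :
  regular_triangulation Om T -> regular_triangulation Om Th ->
  K \in T -> Kh \in Th -> tri_hull K = tri_hull Kh -> has_edge Kh E ->
  K2 \in T -> K2 != K -> has_edge K2 E ->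
  exists K2h, [/\ K2h \in Th, K2h != Kh & has_edge K2h E].
Proof.
move=> [_ A cl C] [_ Ah clh Ch] k kh e h k2 n h2.
have [r pe] := has_edge_perm h2.
set m := pmid E.1 E.2.
have [e0 e00 H] := hull_limit_seq m r Ah.
have mn0 : 0 < Num.min e0 1 by rewrite lt_min e00 ltr01.
(* Below [e0], so that the fine triangle at [x] contains [m]; below 1, so that [x] is interior to
   [K2]. *)
pose t : R := Num.min e0 1 / 2.
have t0 : 0 < t by rewrite divr_gt0.
have [te t1] : t < e0 /\ t < 1.
  have : t < Num.min e0 1 by rewrite /t; lra.
  by rewrite lt_min => /andP[].
set x := combo (1 - t) t 0 m r r in H.
have ix : tri_int K2 x.
  have := A _ k2; rewrite -(perm_area pe) -(perm_int pe) area_gt0 => D.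
  apply/(tri_intP _ D); exists ((1 - t) / 2), ((1 - t) / 2), t; split; [lra|lra|done|lra|].
  by rewrite /x /m /pmid /combo /=; congr (_, _); field.
have : closure Om x by rewrite cl; exists K2 => //; apply: tri_int_hull => //; exact: A.
rewrite clh => -[K2h k2h hx]; exists K2h.
have nh : K2h != Kh.
  apply/eqP => e2; apply: (conforming_int (C _ _ k2 k n) _ (A _ k2) ix).
  by rewrite e -e2.
split=> //; apply: (conforming_edge (Ch _ _ kh k2h _) (Ah _ kh) h); first by rewrite eq_sym.
exact: (H t).
Qed.

(** * Angles and edge lengths *)

Lemma vangleC p q r : vangle p q r = vangle p r q.
Proof.
rewrite /vangle (mulrC (edist q p)); congr (acos (_ / _)).
by rewrite /pdot /= mulrC [X in _ + X]mulrC.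
Qed.

Lemma angles_perm K p q r (w : R) : perm_eq [:: p; q; r] (tverts K) ->
  all (fun a => w <= a) (tangles (p, q, r)) = all (fun a => w <= a) (tangles K).
Proof.
move=> pe; apply: (perm_verts (P := fun K' => all (fun a => w <= a) (tangles K') =
  all (fun a => w <= a) (tangles K)) _ _ pe) => // x y z <-; rewrite /tangles /=.
- by rewrite (vangleC y x z) (vangleC x z y) (vangleC z y x); do !case: (_ <= _).
- by do !case: (_ <= _).
Qed.

Lemma edist_sq p q : edist p q ^+ 2 = pdot (psub p q) (psub p q).
Proof. by rewrite /edist sqr_sqrtr // /pdot addr_ge0 // -expr2 sqr_ge0. Qed.

Lemma edistC p q : edist p q = edist q p.
Proof. by rewrite /edist /pdot /=; congr Num.sqrt; ring. Qed.

(* [sin (angle - w) >= 0], multiplied by the lengths of the two sides *)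
Lemma angle_ge p q r (w : R) : orient p q r != 0 -> 0 < w -> w <= vangle p q r ->
  0 < sin w /\
  sin w * pdot (psub q p) (psub r p) <= cos w * `|orient p q r|.
Proof.
move=> D w0; rewrite /vangle; set d := pdot _ _; set n := edist q p * edist r p.
(* Lagrange's identity; it makes [d / n] the cosine and the absolute value of [orient p q r] over
   [n] the sine of the angle. *)
have n2 : n ^+ 2 = d ^+ 2 + orient p q r ^+ 2.
  by rewrite /n exprMn !edist_sq /d /pdot /orient /=; ring.
have o0 : 0 < orient p q r ^+ 2 by rewrite exprn_even_gt0.
have n0 : 0 < n.
  rewrite lt0r mulr_ge0 ?sqrtr_ge0 // andbT -sqrf_eq0 n2 gt_eqF //.
  by have := sqr_ge0 d; lra.
have c1 : -1 <= d / n <= 1.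
  rewrite -ler_norml -(@ler_pXn2r _ 2) ?nnegrE // expr1n real_normK ?num_real //.
  by rewrite expr_div_n ler_pdivrMr ?exprn_gt0 // n2; lra.
have ca := acosK c1; have sa := sin_acos c1.
have a0 := acos_ge0 c1; have ap := acos_lepi c1.
have {}sa : sin (acos (d / n)) = `|orient p q r| / n.
  have -> : `|orient p q r| / n = Num.sqrt ((`|orient p q r| / n) ^+ 2).
    by rewrite sqrtr_sqr; symmetry; apply: ger0_norm; rewrite divr_ge0 // ltW.
  rewrite sa; congr Num.sqrt.
  rewrite !expr_div_n real_normK ?num_real // n2; field.
  by rewrite -n2 expf_neq0 // gt_eqF.
move=> wa.
have s0 : 0 < sin (acos (d / n)) by rewrite sa divr_gt0 // normr_gt0.
have wpi : w < pi.
  apply: le_lt_trans wa _; rewrite lt_neqAle ap andbT.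
  by apply: contraTneq s0 => ->; rewrite sinpi ltxx.
split; first by apply: sin_gt0_pi; rewrite w0.
have : 0 <= sin (acos (d / n) - w) by apply: sin_ge0_pi; lra.
rewrite sinB sa ca subr_ge0 => h.
have := ler_wpM2l (ltW n0) h.
have -> : n * (d / n * sin w) = sin w * d by field; rewrite gt_eqF.
by have -> : n * (`|orient p q r| / n * cos w) = cos w * `|orient p q r| by field; rewrite gt_eqF.
Qed.

(** The squared length of the edge is the sum of the dot products at its two ends, so the angles
    there bound it from above. The lower bound uses the angle opposite to the edge. *)
Lemma edge_length_sq_le K E (w : R) : 0 < tri_area K -> has_edge K E -> 0 < w ->
  all (fun a => w <= a) (tangles K) ->
  [/\ 0 < sin w, sin w * edge_length E ^+ 2 <= 4 * cos w * tri_area K &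
      2 * sin w * tri_area K <= edge_length E ^+ 2].
Proof.
move=> A h w0; have [r pe] := has_edge_perm h.
move: A; rewrite -(perm_area pe) -(angles_perm _ pe) area_gt0 => D.
rewrite /edge_length tri_area_orient /tv0 /tv1 /tv2 /=.
move: E {h pe} D => [p q] /= D /and4P[wp wq wr _].
have Dq : orient q r p != 0 by rewrite orient_cycle.
have Dr : orient r p q != 0 by rewrite -orient_cycle.
have [s0 dp] := angle_ge D w0 wp; have [_ dq] := angle_ge Dq w0 wq.
have [_ dr] := angle_ge Dr w0 wr.
have oq : orient q r p = orient p q r by rewrite orient_cycle.
have or : orient r p q = orient p q r by rewrite -oq -orient_cycle.
rewrite oq in dq; rewrite or in dr.
set X := `|orient p q r| in dp dq dr *.
set L := edist p q ^+ 2.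
set a := pdot _ _ in dp; set b := pdot _ _ in dq; set c := pdot _ _ in dr.
have Lab : L = a + b by rewrite /L edist_sq /a /b /pdot /=; ring.
have X2 : X ^+ 2 = a * b + c * L.
  rewrite /L edist_sq /X real_normK ?num_real // /a /b /c /pdot /orient /=; ring.
have cs := cos2Dsin2 w.
have X0 : 0 < X by rewrite normr_gt0.
split=> //; first by rewrite Lab; lra.
have L0 : 0 < L.
  rewrite lt0r sqr_ge0 andbT /L sqrf_eq0 /edist sqrtr_eq0 -ltNge.
  have : 0 <= pdot (psub p q) (psub p q) by rewrite /pdot addr_ge0 // -expr2 sqr_ge0.
  rewrite le_eqVlt => /orP[/eqP e|//]; exfalso; move: D => /eqP; apply.
  move: e; rewrite /pdot /= => /esym/eqP; rewrite paddr_eq0 -?expr2 ?sqr_ge0 // !sqrf_eq0 !subr_eq0.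
  by move=> /andP[/eqP e1 /eqP e2]; rewrite /orient e1 e2; ring.
(* Suppose [L < Y] with [Y = s X]. Then [Y^2 - k Y L > (1 - k) L^2]. But [X^2 = a b + c L],
   [4 a b <= L^2] and the opposite angle give [Y^2 - k Y L <= s^2 L^2 / 4 <= (1 - k) L^2 / 2]. *)
rewrite leNgt; apply/negP => Y0.
set s := sin w in s0 dp dq dr cs Y0 *; set k := cos w in dp dq dr cs *.
have k1 : k < 1.
  rewrite ltNge; apply/negP => k1; have : 0 < s ^+ 2 by rewrite exprn_gt0.
  have : 1 <= k ^+ 2 by apply: exprn_ege1.
  by lra.
have k2 : -1 < k.
  rewrite ltNge; apply/negP => k2; have : 0 < s ^+ 2 by rewrite exprn_gt0.
  have : 1 <= (- k) ^+ 2 by apply: exprn_ege1; lra.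
  by rewrite sqrrN; lra.
pose Y := s * X.
have YL : L < Y by rewrite /Y; lra.
have ab : a * b <= L ^+ 2 / 4.
  by have := sqr_ge0 (a - b); rewrite Lab !expr2; lra.
have h1 : Y ^+ 2 <= s ^+ 2 * (L ^+ 2 / 4) + k * Y * L.
  have -> : Y ^+ 2 = s ^+ 2 * (a * b) + s * L * (s * c) by rewrite /Y exprMn X2; ring.
  apply: lerD; first by rewrite ler_wpM2l // sqr_ge0.
  have -> : k * Y * L = s * L * (k * X) by rewrite /Y; ring.
  by rewrite ler_wpM2l // mulr_ge0 // ltW.
have kL : k * L < L by rewrite gtr_pMl.
have h2 : L * (Y - k * L) < Y * (Y - k * L) by rewrite ltr_pM2r //; lra.
have h3 : L * L <= L * Y by rewrite ler_pM2l // ltW.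
have h4 : (1 - k) * (1 + k) * L ^+ 2 <= (1 - k) * 2 * L ^+ 2.
  by rewrite ler_wpM2r ?sqr_ge0 // ler_wpM2l; lra.
have h5 : 0 < (1 - k) * L ^+ 2 by apply: mulr_gt0; [lra|rewrite exprn_gt0].
have s2 : s ^+ 2 = (1 - k) * (1 + k) by lra.
by move: h1; rewrite s2 -mulrA; lra.
Qed.

(** The constant of a single edge; [12 * kappa w] is the radicand of [Lambda1 w]. *)
Definition kappa (w : R) : R := 4 * (cos w / sin w) / Num.sqrt (2 * sin w).

(** [K] carries the weight of the jump term and [K'] the gradient; they may be different triangles,
    linked through the length of the common edge. *)
Lemma sqrt_area_edge K K' E (w : R) : 0 < tri_area K -> 0 < tri_area K' ->
  has_edge K E -> has_edge K' E -> 0 < w ->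
  all (fun a => w <= a) (tangles K) -> all (fun a => w <= a) (tangles K') ->
  Num.sqrt (tri_area K) * edge_length E <= kappa w * tri_area K'.
Proof.
move=> A A' h h' w0 aK aK'.
have [s0 _ h1] := edge_length_sq_le A h w0 aK.
have [_ h2 _] := edge_length_sq_le A' h' w0 aK'.
have q0 : 0 < Num.sqrt (2 * sin w) by rewrite sqrtr_gt0 mulr_gt0.
have E0 : 0 <= edge_length E by exact: sqrtr_ge0.
have {}h1 : Num.sqrt (tri_area K) <= edge_length E / Num.sqrt (2 * sin w).
  rewrite ler_pdivlMr // mulrC -sqrtrM; last by rewrite mulr_ge0 // ltW.
  by rewrite -(ger0_norm E0) -sqrtr_sqr ler_wsqrtr.
apply: le_trans (ler_wpM2r E0 h1) _.
have -> : kappa w * tri_area K' = (4 * cos w * tri_area K') / sin w / Num.sqrt (2 * sin w).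
  by rewrite /kappa; field; rewrite !gt_eqF.
rewrite mulrAC ler_pM2r ?invr_gt0 // ler_pdivlMr // -expr2 mulrC //.
Qed.

End Geometry.

(** * Area as Lebesgue measure *)

Section Measure.
Set Implicit Arguments.
Unset Strict Implicit.
Variable R : realType.
Local Notation pt := (R * R)%type.
Local Open Scope ereal_scope.
Implicit Types (p q r : pt) (K : tri R).

(* No measurability is needed: the integral of a nonnegative function is a
   supremum over the simple functions below it. *)
Lemma ge0_le_integral_sup d (X : measurableType d) (mu : {measure set X -> \bar R})
    (D D' : set X) (f g : X -> \bar R) :
  (forall x, D x -> 0 <= f x) -> (forall x, D' x -> 0 <= g x) ->
  (forall x, D x -> f x <= (g \_ D') x) ->
  \int[mu]_(x in D) f x <= \int[mu]_(x in D') g x.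
Proof.
move=> f0 g0 fg; rewrite !ge0_integralE //.
apply: le_ereal_sup => _ [h /= hf <-]; exists h => //= x.
apply: le_trans (hf x) _; rewrite {1}/patch.
case: ifPn => [/set_mem/fg //|_].
by rewrite /patch; case: ifPn => // /set_mem/g0.
Qed.

Lemma integral_affine (a b al be : R) : (a <= b)%R ->
  \int[@lebesgue_measure R]_(x in `]a, b[) (al * x + be)%:E =
  (((al * (a + b) / 2) + be) * (b - a))%:E.
Proof.
rewrite le_eqVlt => /orP[/eqP <-|ab].
  by rewrite set_itvoo0 // integral_set0 subrr mulr0.
pose F (x : R) := (al / 2 * x ^+ 2 + be * x)%R.
have dF (x : R) : is_derive x (1%R : R) F (al * x + be)%R.
  by apply: is_derive_eq; rewrite /GRing.scale /=; field.
have cF : continuous F.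
  by move=> x; apply/differentiable_continuous/derivable1_diffP; apply: ex_derive.
have cf : continuous (fun x : R => al * x + be)%R.
  move=> x; apply: cvgD; last exact: cvg_cst.
  by apply: cvgM; [exact: cvg_cst|exact: cvg_id].
rewrite -(@integral_itv_bndoo _ _ _ _ true false); last first.
  apply/measurable_EFinP; apply: measurable_funTS.
  exact: continuous_measurable_fun.
rewrite (@continuous_FTC2 _ _ F) //.
- by rewrite /F -EFinB; congr EFin; field.
- exact: continuous_subspaceT.
- split=> [x _| |]; first exact: ex_derive.
  + by apply: cvg_at_right_filter; exact: cF.
  + by apply: cvg_at_left_filter; exact: cF.
- by move=> x _; rewrite derive1E; apply: derive_val.
Qed.

Lemma orient_measurable q r : measurable_fun setT (fun x : pt => orient x q r).
Proof.
rewrite /orient; apply: measurable_funB; apply: measurable_funM;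
  by apply: measurable_funB; (exact: measurable_cst || exact: measurable_fst || exact: measurable_snd).
Qed.

Lemma tri_int_measurable K : measurable (tri_int K).
Proof.
have pos p q r : measurable [set x : pt | (0 < bary p q r x)%R].
  have -> : [set x : pt | (0 < bary p q r x)%R] = setT `&` (bary p q r) @^-1` `]0%R, +oo[.
    by apply/seteqP; split=> x /=; rewrite in_itv /= andbT => // -[].
  have m : measurable_fun setT (bary p q r).
    apply: measurable_funM; last exact: measurable_cst.
    exact: orient_measurable.
  by apply: m.
have -> : tri_int K = [set x | (0 < bary (tv0 K) (tv1 K) (tv2 K) x)%R] `&`
   [set x | (0 < bary (tv1 K) (tv2 K) (tv0 K) x)%R] `&`
   [set x | (0 < bary (tv2 K) (tv0 K) (tv1 K) x)%R].
  by apply/seteqP; split=> x /=; [case|move=> [[]]].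
by apply: measurableI => //; apply: measurableI.
Qed.

(** [D] stands for the signed area, whose sign decides which of [u] and [v] is the lower end of the
    section; dividing by [D] treats both orientations at once. *)
Lemma xsection_ge (A : set pt) (x u v D : R) : measurable A -> D != 0%R ->
  (forall y, 0 < (v - y) / D -> 0 < (y - u) / D -> A (x, y))%R ->
  ((v - u) / D * `|D|)%:E <= (@lebesgue_measure R) (xsection A x).
Proof.
move=> mA D0 h.
have mX : measurable (xsection A x) by exact: measurable_xsection.
have key (a b : R) : (forall y, a < y < b -> A (x, y))%R ->
    (b - a)%:E <= (@lebesgue_measure R) (xsection A x).
  move=> hab; have [ba|ab] := leP b a.
    by apply: (@le_trans _ _ 0) => //; rewrite lee_fin subr_le0.
  have -> : (b - a)%:E = (@lebesgue_measure R) `]a, b[%classic.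
    by rewrite lebesgue_measure_itv /= lte_fin ab EFinB.
  apply: le_measure; rewrite ?inE // => y /=; rewrite in_itv /= => /hab.
  by rewrite /xsection /= => ?; apply/mem_set.
have [D1|D1] := ltP 0%R D.
  rewrite gtr0_norm // divfK //; apply: key => y /andP[h1 h2].
  by apply: h; rewrite divr_gt0 // subr_gt0.
have {}D1 : (D < 0)%R by rewrite lt_neqAle D0.
have -> : ((v - u) / D * `|D| = u - v)%R by rewrite ltr0_norm //; field.
apply: key => y /andP[h1 h2].
by apply: h; rewrite nmulr_lgt0 ?invr_lt0 // subr_lt0.
Qed.

(** The measure is the integral of the section lengths. For a triangle cut by the vertical line
    through its middle vertex, these lengths are affine in each of the two slabs. *)
Lemma leb2_two_slabs (A : set pt) (a b c a1 b1 a2 b2 : R) : measurable A ->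
  (a <= b)%R -> (b <= c)%R ->
  (forall x, a < x < b -> 0 <= a1 * x + b1)%R ->
  (forall x, b < x < c -> 0 <= a2 * x + b2)%R ->
  (forall x, (a < x < b)%R -> (a1 * x + b1)%:E <= (@lebesgue_measure R) (xsection A x)) ->
  (forall x, (b < x < c)%R -> (a2 * x + b2)%:E <= (@lebesgue_measure R) (xsection A x)) ->
  (((a1 * (a + b) / 2) + b1) * (b - a) + ((a2 * (b + c) / 2) + b2) * (c - b))%:E
    <= leb2 A.
Proof.
move=> mA ab bc p1 p2 h1 h2.
rewrite EFinD -!integral_affine //.
pose phi := fun x : R => (@lebesgue_measure R) (xsection A x).
have mphi : measurable_fun setT phi by exact: measurable_fun_xsection.
have -> : leb2 A = \int[@lebesgue_measure R]_x phi x by [].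
apply: (@le_trans _ _ (\int[@lebesgue_measure R]_(x in `]a, b[ `|` `]b, c[) phi x)); last first.
  apply: ge0_subset_integral => //; exact: measurableU.
rewrite ge0_integral_setU //; last 2 first.
- exact: measurable_funTS.
- apply/disj_setPS => x /= []; rewrite !in_itv /= => /andP[_ l1] /andP[l2 _].
  by have := lt_trans l1 l2; rewrite ltxx.
apply: leeD; apply: ge0_le_integral_sup => //= x xI; rewrite /patch mem_set //;
  by move: xI; rewrite in_itv /= => l; (exact: h1 || exact: h2).
Qed.

Lemma tri_int_measure_sorted p q r : orient p q r != 0%R ->
  (p.1 <= q.1)%R -> (q.1 <= r.1)%R ->
  (tri_area (p, q, r))%:E <= leb2 (tri_int (p, q, r)).
Proof.
move=> D pq qr; set A := tri_int _.
have mA : measurable A by exact: tri_int_measurable.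
have pr : (p.1 < r.1)%R.
  rewrite lt_neqAle (le_trans pq qr) andbT; apply: contra_neq D => e.
  have e1 : q.1 = p.1 by apply/eqP; rewrite eq_le pq e qr.
  by rewrite /orient e1 -e; ring.
have rp0 : (r.1 - p.1 != 0)%R by rewrite subr_eq0 gt_eqF.
set d := orient p q r in D *.
have Dq : orient q r p != 0%R by rewrite orient_cycle.
have o1 x : orient x r p = ((x.1 - p.1) * (r.2 - p.2) - (x.2 - p.2) * (r.1 - p.1))%R.
  by rewrite /orient; ring.
have o2 x : orient x p q = ((q.1 - p.1) * (x.2 - p.2) - (q.2 - p.2) * (x.1 - p.1))%R.
  by rewrite /orient; ring.
have o3 x : orient x q r = ((r.1 - q.1) * (x.2 - q.2) - (r.2 - q.2) * (x.1 - q.1))%R.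
  by rewrite /orient; ring.
have d1 : orient q r p = d by rewrite orient_cycle.
have d2 : orient r p q = d by rewrite -d1 orient_cycle.
pose lpr x := (p.2 + (r.2 - p.2) / (r.1 - p.1) * (x - p.1))%R.
(* The section length rises linearly from 0 at [p.1] to [|d| / (r.1 - p.1)] at [q.1] and falls to 0
   at [r.1]. If a slab is empty, division by zero sets its slope to 0. *)
pose al1 := (`|d| / ((r.1 - p.1) * (q.1 - p.1)))%R.
pose al2 := (- (`|d| / ((r.1 - p.1) * (r.1 - q.1))))%R.
have -> : (tri_area (p, q, r) =
    (al1 * (p.1 + q.1) / 2 + - (al1 * p.1)) * (q.1 - p.1) +
    (al2 * (q.1 + r.1) / 2 + - (al2 * r.1)) * (r.1 - q.1))%R.
  rewrite tri_area_orient -/d /al1 /al2; have [e|n1] := eqVneq (q.1 - p.1)%R 0%R.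
    have n2 : (r.1 - q.1 != 0)%R.
      by apply: contra_neq rp0 => e'; rewrite -[LHS](subrKA q.1) e' e addr0.
    have -> : q.1 = p.1 by lra.
    by rewrite subrr !mulr0 add0r; field.
  have [e|n2] := eqVneq (r.1 - q.1)%R 0%R.
    have -> : q.1 = r.1 by lra.
    by rewrite subrr !mulr0 addr0; field.
  by field; rewrite n1 n2 rp0.
apply: leb2_two_slabs => // x /andP[h1 h2].
- have -> : (al1 * x + - (al1 * p.1) = al1 * (x - p.1))%R by ring.
  by rewrite mulr_ge0 ?subr_ge0 ?(ltW h1) // divr_ge0 // mulr_ge0 // subr_ge0 // ltW.
- have -> : (al2 * x + - (al2 * r.1) = - al2 * (r.1 - x))%R by ring.
  by rewrite mulr_ge0 ?subr_ge0 ?(ltW h2) // opprK divr_ge0 // mulr_ge0 // subr_ge0 // ltW.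
- have n1 : (0 < q.1 - p.1)%R by lra.
  pose lpq := (p.2 + (q.2 - p.2) / (q.1 - p.1) * (x - p.1))%R.
  have -> : (al1 * x + - (al1 * p.1) = (lpr x - lpq) / d * `|d|)%R.
    have -> : (lpr x - lpq = d * ((x - p.1) / ((r.1 - p.1) * (q.1 - p.1))))%R.
      by rewrite /lpr /lpq /d /orient; field; rewrite rp0 gt_eqF.
    by rewrite /al1; field; rewrite D rp0 gt_eqF.
  apply: xsection_ge => // y y1 y2.
  have b2 : (0 < bary q r p (x, y))%R.
    have -> : (bary q r p (x, y) = (r.1 - p.1) * ((lpr x - y) / d))%R.
      by rewrite /bary o1 d1 /lpr /=; field; rewrite D rp0.
    by rewrite mulr_gt0 // subr_gt0.
  have b3 : (0 < bary r p q (x, y))%R.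
    have -> : (bary r p q (x, y) = (q.1 - p.1) * ((y - lpq) / d))%R.
      by rewrite /bary o2 d2 /lpq /=; field; rewrite D gt_eqF.
    by rewrite mulr_gt0.
  have s1 := bary_sum (x, y) D.
  have : x = (combo (bary p q r (x, y)) (bary q r p (x, y)) (bary r p q (x, y)) p q r).1.
    by rewrite -(combo_bary (x, y) D).
  rewrite /combo /= => xe; suff b1 : (0 < bary p q r (x, y))%R by split.
  (* A nonpositive weight at [p] and a positive weight at [r] put the abscissa at or beyond [q.1],
     against [x < q.1]. *)
  rewrite ltNge; apply/negP => b1.
  have m1 : (0 <= bary r p q (x, y) * (r.1 - q.1))%R by rewrite mulr_ge0 ?subr_ge0 // ltW.
  have m2 : (0 <= - bary p q r (x, y) * (q.1 - p.1))%R by rewrite mulr_ge0 ?oppr_ge0 // ltW.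
  move: s1 m1 m2 h2 xe.
  set u := bary p q r _; set v := bary q r p _; set w := bary r p q _ => s1.
  have -> : u = (1 - v - w)%R by lra.
  by lra.
- have n1 : (0 < r.1 - q.1)%R by lra.
  pose lqr := (q.2 + (r.2 - q.2) / (r.1 - q.1) * (x - q.1))%R.
  have -> : (al2 * x + - (al2 * r.1) = (lpr x - lqr) / d * `|d|)%R.
    have -> : (lpr x - lqr = d * ((r.1 - x) / ((r.1 - p.1) * (r.1 - q.1))))%R.
      by rewrite /lpr /lqr /d /orient; field; rewrite rp0 gt_eqF.
    by rewrite /al2; field; rewrite D rp0 gt_eqF.
  apply: xsection_ge => // y y1 y2.
  have b2 : (0 < bary q r p (x, y))%R.
    have -> : (bary q r p (x, y) = (r.1 - p.1) * ((lpr x - y) / d))%R.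
      by rewrite /bary o1 d1 /lpr /=; field; rewrite D rp0.
    by rewrite mulr_gt0 // subr_gt0.
  have b1 : (0 < bary p q r (x, y))%R.
    have -> : (bary p q r (x, y) = (r.1 - q.1) * ((y - lqr) / d))%R.
      by rewrite /bary o3 -/d /lqr /=; field; rewrite D gt_eqF.
    by rewrite mulr_gt0.
  have s1 := bary_sum (x, y) D.
  have : x = (combo (bary p q r (x, y)) (bary q r p (x, y)) (bary r p q (x, y)) p q r).1.
    by rewrite -(combo_bary (x, y) D).
  rewrite /combo /= => xe; suff b3 : (0 < bary r p q (x, y))%R by split.
  rewrite ltNge; apply/negP => b3.
  have m1 : (0 <= bary p q r (x, y) * (q.1 - p.1))%R by rewrite mulr_ge0 ?subr_ge0 // ltW.
  have m2 : (0 <= - bary r p q (x, y) * (r.1 - q.1))%R by rewrite mulr_ge0 ?oppr_ge0 // ltW.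
  move: s1 m1 m2 h1 xe.
  set u := bary p q r _; set v := bary q r p _; set w := bary r p q _ => s1.
  have -> : u = (1 - v - w)%R by lra.
  by lra.
Qed.

Lemma tri_int_measure K : (0 < tri_area K)%R -> (tri_area K)%:E <= leb2 (tri_int K).
Proof.
move=> A; pose s := sort (fun a b : pt => a.1 <= b.1)%R (tverts K).
have ps : perm_eq s (tverts K) by rewrite perm_sort.
have : sorted (fun a b : pt => a.1 <= b.1)%R s.
  by apply: sort_sorted => a b; exact: le_total.
move: ps (perm_size ps); case: s => [|p [|q [|r [|? ?]]]] //= pe _ /and3P[pq qr _].
move: A; rewrite -(perm_area pe) -(perm_int pe) area_gt0 => D.
exact: tri_int_measure_sorted.
Qed.

End Measure.

(** * Energy norm and jumps *)

Section Energy.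
Set Implicit Arguments.
Unset Strict Implicit.
Variable R : realType.
Local Notation pt := (R * R)%type.
Local Notation edist := Defs.edist.
Implicit Types (p q r x : pt) (K : tri R).

(** Openness along one direction, the form that meets [lipschitz_domain_exterior]. *)
Lemma tri_int_dir K x (a b : R) : tri_int K x ->
  exists2 e0 : R, 0 < e0 & forall e, 0 < e -> e < e0 -> tri_int K (x.1 + e * a, x.2 + e * b).
Proof.
have key p q r : 0 < bary p q r x -> exists2 e0 : R, 0 < e0 &
    forall e, 0 < e -> e < e0 -> 0 < bary p q r (x.1 + e * a, x.2 + e * b).
  set u := bary _ _ _ x => u0.
  pose v := (b * (r.1 - q.1) + a * (q.2 - r.2)) / orient p q r.
  have v1 : 0 < `|v| + 1 by have := normr_ge0 v; lra.
  exists (u / (`|v| + 1)); first by rewrite divr_gt0.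
  move=> e e0; rewrite ltr_pdivlMr // => l.
  have -> : bary p q r (x.1 + e * a, x.2 + e * b) = u + e * v.
    by rewrite /u /v /bary /orient /=; ring.
  have : - v <= `|v| by rewrite -normrN ler_norm.
  by move/(ler_wpM2l (ltW e0)); lra.
case=> /key[e1 h1 H1] /key[e2 h2 H2] /key[e3 h3 H3].
exists (Num.min e1 (Num.min e2 e3)); first by rewrite !lt_min h1 h2 h3.
by move=> e e0; rewrite !lt_min => /and3P[l1 l2 l3]; split; [exact: H1|exact: H2|exact: H3].
Qed.

Lemma edist_le p q : edist p q <= `|p.1 - q.1| + `|p.2 - q.2|.
Proof.
rewrite /edist -[leRHS]ger0_norm ?addr_ge0 // -sqrtr_sqr ler_wsqrtr //.
rewrite /pdot /psub /= sqrrD !real_normK ?num_real // -!expr2.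
by rewrite lerD2r lerDl mulrn_wge0 // mulr_ge0.
Qed.

Lemma prot_bound (th : R) x : `|(prot th x).1| <= `|x.1| + `|x.2| /\ `|(prot th x).2| <= `|x.1| + `|x.2|.
Proof.
have hc : `|cos th| <= 1 by rewrite ler_norml cos_geN1 cos_le1.
have hs : `|sin th| <= 1 by rewrite ler_norml sin_geN1 sin_le1.
have c1 (t : R) : `|cos th * t| <= `|t| by rewrite normrM ler_piMl.
have s1 (t : R) : `|sin th * t| <= `|t| by rewrite normrM ler_piMl.
split; rewrite /prot /=.
- by apply: le_trans (ler_normB _ _) _; apply: lerD; [exact: c1|exact: s1].
- by apply: le_trans (ler_normD _ _) _; apply: lerD; [exact: s1|exact: c1].
Qed.

(* Near [x] the domain lies strictly below the graph of [phi], so its closure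
   omits the points just above [x] in the rotated frame. *)
Lemma lipschitz_domain_exterior Om x : lipschitz_domain Om -> closure Om x -> ~ Om x ->
  exists a b e0 : R, 0 < e0 /\ forall e, 0 < e -> e < e0 ->
    ~ closure Om (x.1 + e * a, x.2 + e * b).
Proof.
move=> [_ [_ [_ [_ H]]]] cx nx.
have [r [th [L [phi [r0 [L0 [lip hO]]]]]]] := H x (conj cx nx).
(* [prot th] sends this direction to [(0, 1)], the upward one; [r / 8] keeps all points considered
   within distance [r] of [x]. *)
exists (sin th), (cos th), (r / 8); split; first by rewrite divr_gt0.
move=> e e0 er cl.
have phi0 : phi 0 <= 0.
  rewrite leNgt; apply/negP => h; apply: nx; apply/hO.
    by apply: le_lt_trans (edist_le _ _) _; rewrite !subrr normr0 addr0.
  by rewrite /prot /psub /= !subrr !mulr0 !addr0 subrr.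
pose y : pt := (x.1 + e * sin th, x.2 + e * cos th).
(* A point within [dl] of [y] has height at least [e - 2 dl], while the graph there is at most
   [2 L dl]; the sum [2 dl (1 + L)] is only [e / 2]. *)
pose dl := e / (4 * (1 + L)).
have L1 : 0 < 1 + L by lra.
have dl0 : 0 < dl by rewrite divr_gt0 // mulr_gt0.
have [|w [Ow bw]] := cl (ball y dl); first exact: nbhsx_ballx.
have w1 : `|y.1 - w.1| < dl by case: bw.
have w2 : `|y.2 - w.2| < dl by case: bw.
have dle : dl * (4 * (1 + L)) = e by rewrite /dl divfK // gt_eqF // mulr_gt0.
have dlL : 0 <= dl * L by rewrite mulr_ge0 // ltW.
pose z := psub w y.
have [z1 z2] := prot_bound th z.
have zn : `|z.1| + `|z.2| <= 2 * dl.
  by rewrite /z /psub /= (distrC w.1) (distrC w.2); lra.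
have cs := cos2Dsin2 th.
have E1 : (prot th (psub w x)).1 = (prot th z).1.
  by rewrite /prot /z /y /psub /=; ring.
have E2 : (prot th (psub w x)).2 = (prot th z).2 + e.
  rewrite /prot /z /y /psub /=.
  rewrite -[X in _ = _ + X]mulr1 -cs.
  by ring.
have far : edist w x < r.
  apply: le_lt_trans (edist_le _ _) _.
  have hc : `|e * cos th| <= e by rewrite normrM gtr0_norm // ger_pMr // ler_norml cos_geN1 cos_le1.
  have hs : `|e * sin th| <= e by rewrite normrM gtr0_norm // ger_pMr // ler_norml sin_geN1 sin_le1.
  have t1 : `|w.1 - x.1| <= `|z.1| + `|e * sin th|.
    have -> : w.1 - x.1 = z.1 + e * sin th by rewrite /z /y /psub /=; ring.
    exact: ler_normD.
  have t2 : `|w.2 - x.2| <= `|z.2| + `|e * cos th|.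
    have -> : w.2 - x.2 = z.2 + e * cos th by rewrite /z /y /psub /=; ring.
    exact: ler_normD.
  by lra.
move/(hO w far): Ow; rewrite E1 E2; apply/negP; rewrite -leNgt.
have := lip (prot th z).1 0; rewrite subr0 => l.
have l1 : phi (prot th z).1 - phi 0 <= L * (2 * dl).
  apply: le_trans (ler_norm _) (le_trans l _).
  by rewrite ler_wpM2l // (le_trans z1).
have : - (prot th z).2 <= 2 * dl.
  by apply: le_trans (ler_norm _) _; rewrite normrN (le_trans z2).
by lra.
Qed.

(** A point of the open triangle outside [Om] would have exterior points of [Om] arbitrarily near,
    yet all nearby points lie in the triangle and hence in the closure. This excludes slits. *)
Lemma tri_int_domain Om (T : seq (tri R)) K : lipschitz_domain Om ->
  regular_triangulation Om T -> K \in T -> tri_int K `<=` Om.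
Proof.
move=> lipO [_ A cl _] k x ix; apply: contrapT => nx.
have sub y : tri_int K y -> closure Om y.
  by move=> iy; rewrite cl; exists K => //; apply: tri_int_hull => //; exact: A.
have [a [b [e1 [h1 H1]]]] := lipschitz_domain_exterior lipO (sub _ ix) nx.
have [e2 h2 H2] := tri_int_dir a b ix.
pose m := Num.min e1 e2.
have m0 : 0 < m by rewrite lt_min h1 h2.
have m2 : 0 < m / 2 by rewrite divr_gt0.
have : m / 2 < m by lra.
by rewrite lt_min => /andP[l1 l2]; apply: (H1 (m / 2)) => //; apply/sub/H2.
Qed.

(** * Piecewise gradients and the energy *)

(** [gradNC] and [tjump] read the head of a filtered list; uniqueness of the selected element makes
    this head independent of the order of the list. *)
Lemma filter_head (X : eqType) (T : seq X) (P : pred X) a :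
  a \in T -> P a -> (forall b, b \in T -> P b -> b = a) ->
  exists s, [seq b <- T | P b] = a :: s.
Proof.
move=> aT Pa h; have : a \in [seq b <- T | P b] by rewrite mem_filter Pa.
case e: [seq b <- T | P b] => [//|b s] _.
have : b \in [seq b <- T | P b] by rewrite e mem_head.
by rewrite mem_filter => /andP[Pb bT]; exists s; rewrite (h b).
Qed.

Lemma gradNC_int (T : seq (tri R)) v K x : K \in T -> tri_hull K x ->
  (forall K', K' \in T -> tri_hull K' x -> K' = K) -> gradNC T v x = (v K).2.
Proof.
move=> kT hx u; rewrite /gradNC /locate.
have [||s ->//] := @filter_head _ T (fun K => `[< tri_hull K x >]) K kT.
- exact/asboolP.
- by move=> b bT /asboolP; exact: u.
Qed.

Lemma gradNC_bounded (T : seq (tri R)) v : exists M : R, forall x,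
  `|(gradNC T v x).1| <= M /\ `|(gradNC T v x).2| <= M.
Proof.
exists (\sum_(K <- T) (`|(v K).2.1| + `|(v K).2.2|)) => x.
have s0 (s : seq (tri R)) : 0 <= \sum_(K <- s) (`|(v K).2.1| + `|(v K).2.2|).
  by apply: sumr_ge0 => K _; rewrite addr_ge0.
rewrite /gradNC; case e: (locate T x) => [|K s] /=; first by rewrite normr0.
have kT : K \in T.
  have : K \in locate T x by rewrite e mem_head.
  by rewrite mem_filter => /andP[].
rewrite (big_rem K kT) /=; set S := \sum_(_ <- _) _.
have := s0 (rem K T); rewrite -/S; have := normr_ge0 (v K).2.1; have := normr_ge0 (v K).2.2.
by split; lra.
Qed.

Lemma tri_int_unique Om (T : seq (tri R)) K K' x : regular_triangulation Om T ->
  K \in T -> K' \in T -> tri_int K x -> tri_hull K' x -> K' = K.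
Proof.
move=> [_ A _ C] k k' ix hx; apply/eqP/negP => /negP n.
by apply: (conforming_int (C _ _ k k' _) hx (A _ k) ix); rewrite eq_sym.
Qed.

Lemma leb2_box (B : R) : (leb2 (`[(- B)%R, B] `*` `[(- B)%R, B]) < +oo)%E.
Proof.
rewrite /leb2 product_measure1E //.
have h : (@lebesgue_measure R `[(- B)%R, B] < +oo)%E.
  by rewrite /= lebesgue_measure_itv /=; case: ifP => // _; rewrite -EFinB ltry.
by apply: lte_mul_pinfty => //; rewrite ge0_fin_numE.
Qed.

Definition grad_diff2 (T : seq (tri R)) u (Th : seq (tri R)) uh x : R :=
  let d := psub (gradNC T u x) (gradNC Th uh x) in pdot d d.

Lemma pdot_ge0 p : 0 <= pdot p p.
Proof. by rewrite /pdot addr_ge0 // -expr2 sqr_ge0. Qed.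

(** [Rintegral] would turn an infinite integral into 0, so finiteness must be known before a lower
    bound can pass to real numbers. *)
Lemma integral_grad_diff2_lty Om (T Th : seq (tri R)) u uh : lipschitz_domain Om ->
  (\int[@leb2 R]_(x in Om) (grad_diff2 T u Th uh x)%:E < +oo)%E.
Proof.
move=> [_ [_ [_ [[B hB] _]]]].
have [M hM] := gradNC_bounded T u; have [Mh hMh] := gradNC_bounded Th uh.
pose Z := ((M + Mh) ^+ 2 *+ 2)%R.
have Z0 : 0 <= Z by rewrite mulrn_wge0 // sqr_ge0.
have mB : measurable ((`[(- B)%R, B]%classic : set R) `*` (`[(- B)%R, B]%classic : set R)).
  exact: measurableX.
apply: (@le_lt_trans _ _ (\int[@leb2 R]_(x in `[(- B)%R, B] `*` `[(- B)%R, B]) (cst Z%:E x))%E).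
  apply: ge0_le_integral_sup => x Ox; rewrite ?lee_fin ?pdot_ge0 //.
  rewrite /patch mem_set; last first.
    by have [h1 h2] := hB x Ox; split; rewrite /= in_itv /= -ler_norml.
  rewrite lee_fin /grad_diff2 /pdot /psub /=.
  have [m1 m2] := hM x; have [n1 n2] := hMh x.
  have key (s t : R) : `|s| <= M -> `|t| <= Mh -> (s - t) * (s - t) <= (M + Mh) ^+ 2.
    move=> hs ht; rewrite -expr2 -[leLHS]real_normK ?num_real //.
    rewrite ler_pXn2r ?nnegrE //.
      by apply: le_trans (ler_normB _ _) _; rewrite lerD.
    by apply: addr_ge0; [apply: le_trans hs|apply: le_trans ht].
  by rewrite /Z mulr2n; apply: lerD; apply: key.
rewrite integral_cst //; apply: lte_mul_pinfty => //; exact: leb2_box.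
Qed.

(** The share of the fine triangle [K] in the squared energy of [u - uh]; inside [K] the coarse
    gradient is that of its parent. *)
Definition gap_energy (u uh : tri R -> affine R) (par : tri R -> tri R) K : R :=
  let d := psub (u (par K)).2 (uh K).2 in tri_area K * pdot d d.

Lemma energy_ge Om (T Th : seq (tri R)) u uh (par : tri R -> tri R) :
  lipschitz_domain Om -> regular_triangulation Om T -> regular_triangulation Om Th ->
  (forall Kh, Kh \in Th -> par Kh \in T /\ tri_hull Kh `<=` tri_hull (par Kh)) ->
  \sum_(Kh <- Th) gap_energy u uh par Kh <= energy_diff Om T u Th uh ^+ 2.
Proof.
move=> lipO rT rTh hpar.
pose c Kh := pdot (psub (u (par Kh)).2 (uh Kh).2) (psub (u (par Kh)).2 (uh Kh).2).
have c0 Kh : 0 <= c Kh by exact: pdot_ge0.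
have [uTh Ah _ _] := rTh; have [_ A _ _] := rT.
(* A step function that equals the integrand on each open fine triangle and is 0 elsewhere, so it
   lies below the integrand extended by 0. *)
pose F x := \sum_(Kh <- Th) c Kh * \1_(tri_int Kh) x.
have F0 x : 0 <= F x by apply: sumr_ge0 => K _; rewrite mulr_ge0.
have lower : ((\sum_(Kh <- Th) tri_area Kh * c Kh)%:E <=
    \int[@leb2 R]_(x in Om) (grad_diff2 T u Th uh x)%:E)%E.
  apply: (@le_trans _ _ (\int[@leb2 R]_(x in setT) (F x)%:E)%E).
    under eq_integral do rewrite -sumEFin.
    rewrite ge0_integral_sum //; first last.
    - by move=> K x _; rewrite lee_fin mulr_ge0.
    - move=> K; apply/measurable_EFinP; apply: measurable_funM => //.
      by apply: measurable_indic; exact: tri_int_measurable.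
    rewrite -sumEFin big_seq [leRHS]big_seq; apply: lee_sum => K kT.
    under eq_integral do rewrite EFinM.
    rewrite ge0_integralZl_EFin //; last first.
      apply/measurable_EFinP; apply: measurable_indic; exact: tri_int_measurable.
    rewrite integral_indic ?setIT //; last exact: tri_int_measurable.
    by rewrite mulrC EFinM; apply: lee_wpmul2l; rewrite ?lee_fin //; apply: tri_int_measure; exact: Ah.
  apply: ge0_le_integral_sup => x; rewrite ?lee_fin ?pdot_ge0 // => _.
  have [[K kT ix]|no] := pselect (exists2 K, K \in Th & tri_int K x); last first.
    rewrite (_ : F x = 0); first by rewrite /patch; case: ifP; rewrite lee_fin // pdot_ge0.
    rewrite /F big_seq big1 // => K kT; rewrite indicE memNset ?mulr0 //.
    by move=> ix; apply: no; exists K.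
  have xO : Om x by exact: (tri_int_domain lipO rTh kT).
  rewrite /patch mem_set // lee_fin.
  have -> : F x = c K.
    rewrite /F (bigD1_seq K) //= indicE mem_set // mulr1 big_seq_cond big1 ?addr0 //.
    move=> K' /andP[k' n]; rewrite indicE memNset ?mulr0 // => ix'.
    move/eqP: n; apply; apply: (tri_int_unique rTh kT k' ix).
    by apply: tri_int_hull => //; exact: Ah.
  have [pT sub] := hpar K kT.
  rewrite /grad_diff2 (@gradNC_int T u (par K) x) //; first last.
  - move=> K' k' hx'; apply: (tri_int_unique rT pT k' _ hx').
    by apply: tri_int_subset sub _ ix; [exact: A|exact: Ah].
  - by apply/sub/tri_int_hull => //; exact: Ah.
  rewrite (@gradNC_int Th uh K x) //.
  - by apply: tri_int_hull => //; exact: Ah.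
  - by move=> K' k'; exact: (tri_int_unique rTh).
have upper := integral_grad_diff2_lty T Th u uh lipO.
have {}lower : \sum_(Kh <- Th) tri_area Kh * c Kh <= Rintegral (@leb2 R) Om (grad_diff2 T u Th uh).
  rewrite -lee_fin /Rintegral fineK // ge0_fin_numE //.
  by apply: integral_ge0 => x _; rewrite lee_fin pdot_ge0.
rewrite /energy_diff sqr_sqrtr //; apply: le_trans lower.
by apply: sumr_ge0 => K _; rewrite mulr_ge0 // tri_area_orient divr_ge0.
Qed.

(** * The reverse triangle inequality for weighted sums *)

(** [A] acts as one more coordinate, with the same entry in both vectors; it stands for the common
    volume terms and cancels in the difference of the vectors. *)
Lemma cauchy_schwarz_sum (I : Type) (s : seq I) (A : R) (c x y : I -> R) :
  0 <= A -> (forall i, 0 <= c i) ->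
  (A + \sum_(i <- s) c i * (x i * y i)) ^+ 2 <=
  (A + \sum_(i <- s) c i * x i ^+ 2) * (A + \sum_(i <- s) c i * y i ^+ 2).
Proof.
move=> A0 c0; elim: s => [|i s IH]; first by rewrite !big_nil addr0 expr2.
rewrite !big_cons !(addrCA A).
move: IH; set B := A + _; set X := A + _; set Y := A + _ => IH.
have X0 : 0 <= X by rewrite addr_ge0 // sumr_ge0 // => j _; rewrite mulr_ge0 // sqr_ge0.
have Y0 : 0 <= Y by rewrite addr_ge0 // sumr_ge0 // => j _; rewrite mulr_ge0 // sqr_ge0.
set a := x i; set b := y i.
have W0 : 0 <= X * b ^+ 2 + Y * a ^+ 2 by rewrite addr_ge0 // mulr_ge0 // sqr_ge0.
(* Arithmetic and geometric mean with the induction hypothesis: [(X b^2 + Y a^2)^2 >= 4 X Y a^2 b^2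
   >= (2 B a b)^2]. *)
have key : 2 * B * (a * b) <= X * b ^+ 2 + Y * a ^+ 2.
  rewrite leNgt; apply/negP => h.
  have : (X * b ^+ 2 + Y * a ^+ 2) ^+ 2 < (2 * B * (a * b)) ^+ 2.
    by rewrite ltr_pXn2r // nnegrE // ltW // (le_lt_trans W0).
  rewrite ltNge => /negP; apply.
  have := ler_wpM2r (sqr_ge0 (a * b)) IH.
  have := sqr_ge0 (X * b ^+ 2 - Y * a ^+ 2); lra.
by have := ler_wpM2l (c0 i) key; lra.
Qed.

Lemma reverse_triangle_sum (I : Type) (s : seq I) (A : R) (c x y : I -> R) :
  0 <= A -> (forall i, 0 <= c i) ->
  `|Num.sqrt (A + \sum_(i <- s) c i * x i ^+ 2) -
    Num.sqrt (A + \sum_(i <- s) c i * y i ^+ 2)| <=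
  Num.sqrt (\sum_(i <- s) c i * (x i - y i) ^+ 2).
Proof.
move=> A0 c0; have := cauchy_schwarz_sum s x y A0 c0.
have -> : \sum_(i <- s) c i * (x i - y i) ^+ 2 =
    (A + \sum_(i <- s) c i * x i ^+ 2) + (A + \sum_(i <- s) c i * y i ^+ 2)
    - 2 * (A + \sum_(i <- s) c i * (x i * y i)).
  rewrite mulrDr mulr_sumr (_ : forall a b d e : R, a + b + (a + d) - (2 * a + e) = b + d - e).
    by rewrite -big_split -sumrB; apply: eq_bigr => i _ /=; ring.
  by move=> *; ring.
set B := A + _; set X := A + _; set Y := A + _ => CS.
have X0 : 0 <= X by rewrite addr_ge0 // sumr_ge0 // => j _; rewrite mulr_ge0 // sqr_ge0.
have Y0 : 0 <= Y by rewrite addr_ge0 // sumr_ge0 // => j _; rewrite mulr_ge0 // sqr_ge0.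
rewrite -sqrtr_sqr ler_wsqrtr // sqrrB !sqr_sqrtr //.
have : B <= Num.sqrt X * Num.sqrt Y.
  apply: le_trans (ler_norm _) _; rewrite -sqrtrM // -sqrtr_sqr.
  exact: ler_wsqrtr.
by rewrite mulr2n; lra.
Qed.

(** * Jumps and neighbours in the two meshes *)

Lemma sum_tedges K K' (G : pt * pt -> R) : (forall p q, G (q, p) = G (p, q)) ->
  perm_eq (tverts K') (tverts K) ->
  \sum_(E <- tedges K') G E = \sum_(E <- tedges K) G E.
Proof.
case: K' => [[p q] r] Gs pe.
apply: (perm_verts (P := fun K' => \sum_(E <- tedges K') G E = \sum_(E <- tedges K) G E) _ _ pe) => // x y z <-;
  rewrite /tedges !big_cons !big_nil /= !addr0.
- by rewrite (Gs x y) (Gs z x) (Gs y z); ring.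
- by ring.
Qed.

Lemma edge_length_rev (E : pt * pt) : edge_length (E.2, E.1) = edge_length E.
Proof. exact: edistC. Qed.

Lemma tjump_rev T u K p q : tjump T u K (q, p) ^+ 2 = tjump T u K (p, q) ^+ 2.
Proof.
rewrite /tjump (edge_length_rev (p, q)).
have -> : [seq K' <- T | (K' != K) && has_edge K' (q, p)] =
          [seq K' <- T | (K' != K) && has_edge K' (p, q)].
  apply: eq_filter => K'; congr andb; apply: same_has_edge.
  by rewrite /same_edge /= !eqxx orbT.
have e v : pdot v (psub p q) = - pdot v (psub q p) by rewrite /pdot /=; ring.
case: (seq.filter _ T) => [|K' s];
  by rewrite /= e mulNr sqrrN.
Qed.

Lemma tangential_le (v t : pt) (n : R) : n ^+ 2 = pdot t t -> (pdot v t / n) ^+ 2 <= pdot v v.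
Proof.
move=> n2; have [->|n0] := eqVneq n 0; first by rewrite invr0 mulr0 expr0n pdot_ge0.
rewrite expr_div_n ler_pdivrMr ?exprn_even_gt0 // n2 -subr_ge0.
have -> : pdot v v * pdot t t - pdot v t ^+ 2 = (v.1 * t.2 - v.2 * t.1) ^+ 2.
  by rewrite /pdot; ring.
exact: sqr_ge0.
Qed.

Lemma pdot_sub_le (v w : pt) : pdot (psub v w) (psub v w) <= 2 * (pdot v v + pdot w w).
Proof. by have := pdot_ge0 (v.1 + w.1, v.2 + w.2); rewrite /pdot /psub /=; lra. Qed.

(** After exchanging the sums, each pair [(K, E)] that counts [K2] belongs to one of its three edges
    [F]. [neighbour_unique] leaves one [K] for each [F], and the distinct vertices of [K] leave one
    [E]. *)
Lemma sum_neighbours_le Om (T : seq (tri R)) (e : tri R -> R) :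
  regular_triangulation Om T -> (forall K, 0 <= e K) ->
  \sum_(K <- T) \sum_(E <- tedges K) \sum_(K2 <- T | (K2 != K) && has_edge K2 E) e K2
  <= 3 * \sum_(K <- T) e K.
Proof.
move=> rT e0; have [uT A _ _] := rT.
have one K2 F : K2 \in T -> F \in tedges K2 ->
    \sum_(K <- T) \sum_(E <- tedges K) (if (K2 != K) && same_edge E F then e K2 else 0) <= e K2.
  move=> k2 f2; have [[K k /andP[n h]]|no] :=
      pselect (exists2 K, K \in T & (K2 != K) && has_edge K F); last first.
    rewrite big_seq big1 // => K k; rewrite big_seq big1 // => E EK.
    case: ifP => // /andP[n h]; case: no; exists K => //.
    by rewrite n -(same_has_edge _ h) tedge_has_edge.
  rewrite (bigD1_seq K) //= [X in _ + X]big_seq_cond [X in _ + X]big1 ?addr0; last first.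
    move=> K' /andP[k' n']; rewrite big_seq big1 // => E EK.
    case: ifP => // /andP[n2 h']; case/negP: n'; apply/eqP.
    apply: (neighbour_unique rT k2 k' k (E := F)) => //; rewrite ?(eq_sym _ K2) //.
    - exact: tedge_has_edge.
    - by rewrite -(same_has_edge _ h') tedge_has_edge.
  have [r pe] := has_edge_perm h; rewrite n /=.
  rewrite -(@sum_tedges _ (F.1, F.2, r)) //; last first.
    move=> p q; congr (if _ then _ else _).
    by rewrite same_edgeC -(same_edge_rev _ (q, p)) same_edgeC.
  have := A _ k; rewrite -(perm_area pe) area_gt0 => D.
  have n12 : F.1 != F.2 by apply: contra_neq D => ->; rewrite orient0.
  have n1r : F.1 != r by apply: contra_neq D => ->; rewrite orient0.
  have n2r : F.2 != r by apply: contra_neq D => ->; rewrite orient0.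
  rewrite /tedges !big_cons big_nil /same_edge /tv0 /tv1 /tv2 /=.
  rewrite !eqxx (negbTE n12) !(eq_sym F.2) !(eq_sym r) (negbTE n12) (negbTE n1r) (negbTE n2r) /=.
  by rewrite !addr0.
have -> : \sum_(K <- T) \sum_(E <- tedges K) \sum_(K2 <- T | (K2 != K) && has_edge K2 E) e K2 =
    \sum_(K2 <- T) \sum_(K <- T) \sum_(E <- tedges K)
      (if (K2 != K) && has_edge K2 E then e K2 else 0).
  rewrite exchange_big; apply: eq_bigr => K _; rewrite exchange_big.
  by apply: eq_bigr => E _; rewrite big_mkcond.
rewrite mulr_sumr big_seq [leRHS]big_seq; apply: ler_sum => K2 k2.
apply: (@le_trans _ _ (\sum_(F <- tedges K2) \sum_(K <- T) \sum_(E <- tedges K)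
    (if (K2 != K) && same_edge E F then e K2 else 0))).
  rewrite [leRHS]exchange_big; apply: ler_sum => K _.
  rewrite [leRHS]exchange_big; apply: ler_sum => E _.
  have pos (s : seq (pt * pt)) :
      0 <= \sum_(F <- s) (if (K2 != K) && same_edge E F then e K2 else 0).
    by apply: sumr_ge0 => F _; case: ifP.
  case: ifP => [/andP[n /hasP[F FK h]]|_]; last exact: pos.
  by rewrite (big_rem F FK) /= {1}n h /= lerDl pos.
have := one K2 _ k2; rewrite /tedges !big_cons big_nil => o.
have := o _ (mem_nth (tv0 K2, tv1 K2) (isT : (0 < size (tedges K2))%N)).
have := o _ (mem_nth (tv0 K2, tv1 K2) (isT : (1 < size (tedges K2))%N)).
have := o _ (mem_nth (tv0 K2, tv1 K2) (isT : (2 < size (tedges K2))%N)).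
by rewrite /=; lra.
Qed.

(** The match mirrors the branch in [tjump]: [E] is a boundary edge in both meshes or in neither,
    and the coarse neighbour is the parent of the fine one. *)
Lemma neighbour_transfer Om (T Th : seq (tri R)) K Kh E (par : tri R -> tri R) :
  regular_triangulation Om T -> regular_triangulation Om Th ->
  (forall Kh, Kh \in Th -> par Kh \in T /\ tri_hull Kh `<=` tri_hull (par Kh)) ->
  K \in T -> Kh \in Th -> tri_hull K = tri_hull Kh -> has_edge Kh E ->
  match [seq K' <- Th | (K' != Kh) && has_edge K' E] with
  | [::] => [seq K' <- T | (K' != K) && has_edge K' E] = [::]
  | K2h :: _ => exists s, [seq K' <- T | (K' != K) && has_edge K' E] = par K2h :: s
  end.
Proof.
move=> rT rTh hpar k kh e h.
have [_ A _ _] := rT; have [_ Ah _ _] := rTh.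
have h' : has_edge K E.
  move: h; case/has_edge_perm => r pe; apply: (@perm_edge _ _ _ _ r); case: E pe => a b /= pe.
  by apply: perm_trans pe _; apply: hull_eq_verts; [exact: Ah|exact: A|].
case eh: (seq.filter _ Th) => [|K2h s].
  case et: (seq.filter _ T) => [//|K2 s].
  have : K2 \in [seq K' <- T | (K' != K) && has_edge K' E] by rewrite et mem_head.
  rewrite mem_filter => /andP[/andP[n2 h2] k2].
  have [K2h [k2h n2h h2h]] := coarse_neighbour rT rTh k kh e h k2 n2 h2.
  have : K2h \in [seq K' <- Th | (K' != Kh) && has_edge K' E].
    by rewrite mem_filter n2h h2h k2h.
  by rewrite eh.
have : K2h \in [seq K' <- Th | (K' != Kh) && has_edge K' E] by rewrite eh mem_head.
rewrite mem_filter => /andP[/andP[n2h h2h] k2h].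
have [k2 sub] := hpar _ k2h.
have [n2 h2] := fine_neighbour rT rTh k kh e h' k2 k2h sub n2h h2h.
apply: (filter_head (P := fun K' => (K' != K) && has_edge K' E)) => //.
  by rewrite n2 h2.
by move=> K3 k3 /andP[n3 h3]; apply: (neighbour_unique rT k k3 k2 n3 n2 h').
Qed.

(** The indicator of [K] is rewritten over the edges of [Kh], so that the jumps in both meshes run
    along the same oriented edges and can be subtracted. *)
Lemma eta2_perm f T u K Kh : 0 < tri_area K -> 0 < tri_area Kh ->
  tri_hull K = tri_hull Kh ->
  eta2 f T u K = tri_area Kh * Rintegral (@leb2 R) (tri_hull Kh) (fun x => f x ^+ 2) +
    \sum_(E <- tedges Kh)
       Num.sqrt (tri_area Kh) * edge_length E * tjump T u K E ^+ 2.
Proof.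
move=> A Ah e; have pe := hull_eq_verts A Ah e.
have ea : tri_area K = tri_area Kh by move: pe; case: (K) => [[p q] r]; exact: perm_area.
rewrite /eta2 e ea; congr (_ + _).
rewrite (sum_tedges (K := Kh)) //; last by move=> p q; rewrite tjump_rev (edge_length_rev (p, q)).
by rewrite mulr_sumr; apply: eq_bigr => E _; rewrite mulrA.
Qed.

(** The two jumps differ by the tangential part of [d Kh - d K2], or of [d Kh] at a boundary edge.
    The sum on the right has at most one term; it is written as a sum to fit [sum_neighbours_le]. *)
Lemma jump_diff_le Om (T Th : seq (tri R)) u uh w Kh E (par : tri R -> tri R) :
  regular_triangulation Om T -> regular_triangulation Om Th ->
  (forall K, K \in Th -> par K \in T /\ tri_hull K `<=` tri_hull (par K)) ->
  0 < w -> (forall K, K \in Th -> all (fun a => w <= a) (tangles K)) ->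
  Kh \in Th -> tri_hull (par Kh) = tri_hull Kh -> E \in tedges Kh ->
  Num.sqrt (tri_area Kh) * edge_length E * (tjump T u (par Kh) E - tjump Th uh Kh E) ^+ 2 <=
  2 * kappa w * (gap_energy u uh par Kh +
    \sum_(K <- Th | (K != Kh) && has_edge K E) gap_energy u uh par K).
Proof.
move=> rT rTh hpar w0 ang kh eh EK; set e := gap_energy u uh par.
have h := tedge_has_edge EK; have [_ A _ _] := rT; have [_ Ah _ _] := rTh.
have [pk _] := hpar _ kh.
have := neighbour_transfer rT rTh hpar pk kh eh h.
pose d K := psub (u (par K)).2 (uh K).2.
set t := psub E.2 E.1.
have t2 : edge_length E ^+ 2 = pdot t t by rewrite /edge_length edist_sq /t /pdot /=; ring.
have w_ge0 : 0 <= Num.sqrt (tri_area Kh) * edge_length E by rewrite mulr_ge0 // sqrtr_ge0.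
have bound K v : K \in Th -> has_edge K E -> 0 <= v ->
    Num.sqrt (tri_area Kh) * edge_length E * v <= kappa w * (tri_area K * v).
  move=> k hK v0; rewrite mulrA ler_wpM2r //.
  by apply: sqrt_area_edge => //; [exact: Ah|exact: Ah|exact: ang|exact: ang].
have e0 K : 0 <= e K.
  by rewrite /e /gap_energy mulr_ge0 ?pdot_ge0 // tri_area_orient divr_ge0.
(* The sign of [cos w] is not examined; the term dominates a nonnegative quantity by [bound]. *)
have ke K : K \in Th -> has_edge K E -> 0 <= kappa w * e K.
  by move=> k hK; apply: le_trans (bound _ _ k hK (pdot_ge0 (d K))); rewrite mulr_ge0 // pdot_ge0.
rewrite -big_filter /tjump -/t.
case eF: (seq.filter _ Th) => [|K2 s].
  move=> ->; rewrite big_nil addr0.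
  have -> : pdot (u (par Kh)).2 t / edge_length E - pdot (uh Kh).2 t / edge_length E =
      pdot (d Kh) t / edge_length E by rewrite /d /pdot /=; ring.
  apply: (@le_trans _ _ (Num.sqrt (tri_area Kh) * edge_length E * pdot (d Kh) (d Kh))).
    by rewrite ler_wpM2l // tangential_le.
  have := bound Kh _ kh h (pdot_ge0 (d Kh)); have := ke _ kh h.
  rewrite -[tri_area Kh * _]/(e Kh); lra.
move=> [s' ->]; rewrite big_cons.
have : K2 \in [seq K' <- Th | (K' != Kh) && has_edge K' E] by rewrite eF mem_head.
rewrite mem_filter => /andP[/andP[n2 h2] k2].
have -> : pdot (psub (u (par Kh)).2 (u (par K2)).2) t / edge_length E -
    pdot (psub (uh Kh).2 (uh K2).2) t / edge_length E =
    pdot (psub (d Kh) (d K2)) t / edge_length E by rewrite /d /pdot /=; ring.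
have sF : 0 <= \sum_(K <- s) kappa w * e K.
  rewrite big_seq; apply: sumr_ge0 => K ks.
  have : K \in [seq K' <- Th | (K' != Kh) && has_edge K' E] by rewrite eF inE ks orbT.
  by rewrite mem_filter => /andP[/andP[_ hK] k]; exact: ke.
rewrite -mulr_sumr in sF.
apply: (@le_trans _ _ (Num.sqrt (tri_area Kh) * edge_length E *
    (2 * (pdot (d Kh) (d Kh) + pdot (d K2) (d K2))))).
  rewrite ler_wpM2l //; apply: le_trans (tangential_le _ t2) _; exact: pdot_sub_le.
have := bound Kh _ kh h (pdot_ge0 (d Kh)); have := bound K2 _ k2 h2 (pdot_ge0 (d K2)).
rewrite -[tri_area Kh * _]/(e Kh) -[tri_area K2 * _]/(e K2); lra.
Qed.

End Energy.

(** * The estimate on the common triangles *)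

Theorem theorem6p3 (R : realType) (Om : set (R * R)) (T0 : seq (tri R))
    (w0 : R) (f : R * R -> R) (T Th : seq (tri R)) (u uh : tri R -> affine R) :
  lipschitz_domain Om ->
  regular_triangulation Om T0 ->
  0 < w0 ->
  (forall T', admissible Om T0 T' ->
     forall K, K \in T' -> all (fun a => w0 <= a) (tangles K)) ->
  L2 Om f ->
  admissible Om T0 T -> admissible Om T0 Th -> refines Th T ->
  CR_solution Om f T u -> CR_solution Om f Th uh ->
  `| eta_common f T u Th - eta_common f Th uh T |
    <= Lambda1 w0 * energy_diff Om T u Th uh.
Proof.
move=> lipO _ w0_gt0 hang _ [_ rT] aTh ref _ _.
have [_ rTh] := aTh; have ang := hang _ aTh.
(* A parent map; outside [Th] its value is an arbitrary default. *)
have /choice[par hpar] (Kh : tri R) : exists K : tri R,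
    Kh \in Th -> K \in T /\ tri_hull Kh `<=` tri_hull K.
  have [kh|kh] := boolP (Kh \in Th); last by exists Kh.
  by have [K k s] := ref _ kh; exists K.
have [uT A _ _] := rT; have [uTh Ah _ _] := rTh.
pose common (S : seq (tri R)) K := has (fun K' => `[< tri_hull K' = tri_hull K >]) S.
pose C := [seq Kh <- Th | common T Kh].
have CTh Kh : Kh \in C -> Kh \in Th by rewrite mem_filter => /andP[].
have parC Kh : Kh \in C -> tri_hull (par Kh) = tri_hull Kh.
  rewrite mem_filter => /andP[/hasP[K k /asboolP e] kh].
  have [pk sub] := hpar _ kh.
  by rewrite (parent_unique rT (Ah _ kh) pk k sub) // e.
(* [par] is a bijection from the fine copies of the common triangles to their coarse copies, so both
   estimators become sums over [C]. *)
have permC : perm_eq [seq K <- T | common Th K] [seq par Kh | Kh <- C].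
  apply: uniq_perm; first exact: filter_uniq.
    rewrite map_inj_in_uniq ?filter_uniq // => K K' k k' e.
    apply: (parent_unique rTh (Ah _ (CTh _ k)) (CTh _ k) (CTh _ k')) => //.
    by rewrite -(parC _ k) -(parC _ k') e.
  move=> K; apply/idP/mapP => [|[Kh kh ->]].
    rewrite mem_filter => /andP[/hasP[Kh kh /asboolP e] k].
    have kC : Kh \in C by rewrite mem_filter kh andbT; apply/hasP; exists K => //; exact/asboolP.
    exists Kh => //; have [pk sub] := hpar _ kh.
    by apply: (parent_unique rT (Ah _ kh) k pk _ sub); rewrite e.
  have [pk _] := hpar _ (CTh _ kh); rewrite mem_filter pk andbT.
  by apply/hasP; exists Kh; [exact: CTh|apply/asboolP; rewrite parC].
pose a Kh := tri_area Kh * Rintegral (@leb2 R) (tri_hull Kh) (fun x => f x ^+ 2).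
pose wt (i : tri R * (R * R * (R * R))) := Num.sqrt (tri_area i.1) * edge_length i.2.
pose idx := [seq (Kh, E) | Kh <- C, E <- tedges Kh].
have area0 (K : tri R) : 0 <= tri_area K by rewrite tri_area_orient divr_ge0.
have A0 : 0 <= \sum_(Kh <- C) a Kh.
  apply: sumr_ge0 => K _; rewrite mulr_ge0 //; apply: Rintegral_ge0 => x _; exact: sqr_ge0.
have wt0 i : 0 <= wt i by rewrite mulr_ge0 // sqrtr_ge0.
have -> : eta_common f T u Th = Num.sqrt (\sum_(Kh <- C) a Kh +
    \sum_(i <- idx) wt i * tjump T u (par i.1) i.2 ^+ 2).
  rewrite /eta_common -big_filter (perm_big _ permC) big_map big_allpairs_dep -big_split /=.
  congr Num.sqrt; rewrite big_seq [RHS]big_seq; apply: eq_bigr => Kh kh.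
  by rewrite (@eta2_perm _ _ _ _ _ Kh) ?parC //; [apply: A; case: (hpar _ (CTh _ kh))|exact/Ah/CTh].
have -> : eta_common f Th uh T = Num.sqrt (\sum_(Kh <- C) a Kh +
    \sum_(i <- idx) wt i * tjump Th uh i.1 i.2 ^+ 2).
  rewrite /eta_common -big_filter big_allpairs_dep -big_split /=.
  congr Num.sqrt; rewrite big_seq [RHS]big_seq; apply: eq_bigr => Kh kh.
  by rewrite (@eta2_perm _ _ _ _ _ Kh) //; exact/Ah/CTh.
apply: le_trans (reverse_triangle_sum _ _ _ A0 wt0) _.
rewrite big_allpairs_dep /=.
pose e := gap_energy u uh par.
have e0 K : 0 <= e K by rewrite mulr_ge0 // pdot_ge0.
(* Without common triangles the left side is 0; otherwise a triangle of [C] serves to derive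
   [0 <= kappa w0]. *)
have [Th0|[K0 k0]] : C = [::] \/ exists K, K \in C.
- by case: (C) => [|K s]; [left|right; exists K; rewrite mem_head].
- by rewrite Th0 big_nil sqrtr0 mulr_ge0 // sqrtr_ge0.
have kap : 0 <= kappa w0.
  have k1 := CTh _ k0; have h0 := tedge_has_edge (mem_head (tv0 K0, tv1 K0) _ : _ \in tedges K0).
  have := sqrt_area_edge (Ah _ k1) (Ah _ k1) h0 h0 w0_gt0 (ang _ k1) (ang _ k1).
  move=> h; have : 0 <= kappa w0 * tri_area K0.
    by apply: le_trans h; rewrite mulr_ge0 // sqrtr_ge0.
  by rewrite pmulr_lge0 // Ah.
have main : \sum_(Kh <- C) \sum_(E <- tedges Kh)
    wt (Kh, E) * (tjump T u (par Kh) E - tjump Th uh Kh E) ^+ 2 <=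
    12 * kappa w0 * \sum_(K <- Th) e K.
  apply: (@le_trans _ _ (\sum_(Kh <- C) \sum_(E <- tedges Kh) 2 * kappa w0 *
      (e Kh + \sum_(K <- Th | (K != Kh) && has_edge K E) e K))).
    rewrite big_seq [leRHS]big_seq; apply: ler_sum => Kh kh.
    rewrite big_seq [leRHS]big_seq; apply: ler_sum => E hE.
    exact: (jump_diff_le u uh rT rTh hpar w0_gt0 ang (CTh _ kh) (parC _ kh) hE).
  have nn Kh E : 0 <= 2 * kappa w0 * (e Kh + \sum_(K <- Th | (K != Kh) && has_edge K E) e K).
    by apply: mulr_ge0; [exact: mulr_ge0|apply: addr_ge0 => //; exact: sumr_ge0].
  (* By nonnegativity the sum may grow from [C] to all of [Th], the range that [sum_neighbours_le]
     counts. *)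
  apply: (@le_trans _ _ (\sum_(Kh <- Th) \sum_(E <- tedges Kh) 2 * kappa w0 *
      (e Kh + \sum_(K <- Th | (K != Kh) && has_edge K E) e K))).
    rewrite big_filter big_mkcond; apply: ler_sum => Kh _; case: ifP => // _.
    exact: sumr_ge0.
  under eq_bigr do rewrite -mulr_sumr big_split /=.
  rewrite -mulr_sumr big_split /=.
  have -> : \sum_(K <- Th) \sum_(E <- tedges K) e K = 3 * \sum_(K <- Th) e K.
    rewrite mulr_sumr; apply: eq_bigr => K _.
    by rewrite /tedges !big_cons big_nil; ring.
  have := ler_wpM2l kap (sum_neighbours_le rTh e0).
  by lra.
have k12 : 0 <= 12 * kappa w0 by apply: mulr_ge0 kap.
apply: (@le_trans _ _ (Num.sqrt (12 * kappa w0 * energy_diff Om T u Th uh ^+ 2))).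
  apply: ler_wsqrtr; apply: le_trans main (ler_wpM2l k12 _).
  exact: (energy_ge u uh lipO rT rTh hpar).
rewrite sqrtrM // sqrtr_sqr ger0_norm ?sqrtr_ge0 // /Lambda1.
have -> // : 12 * kappa w0 = 48 * (cos w0 / sin w0) / Num.sqrt (2 * sin w0).
by rewrite /kappa; ring.
Qed.
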